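(* Assume the setting and Assumption (DG) described in the context, with true task $\theta^*\in\Theta$ and reference task $\bar\theta\in\Theta$ with $\pi(\bar\theta)>0$. Then for any $r\in(0,1)$ and any $T\ge1$, with $Z=z_{1:T}\sim p_T(\cdot\mid\theta^* )$, $$\mathbb{E}_{Z}\Big[\mathbb{E}_{\theta\sim\pi_T(\cdot\mid Z)}\big[D_{r,T}(\theta,\theta^* )\big]\Big] \le -\frac{1+r}{(1-r)T}\log\Big(\mathbb{E}_{\theta\sim\pi}\Big[\exp\Big(-\mathbb{E}_{Z}\Big[\log\frac{p_T(Z\mid\bar\theta)}{p_T(Z\mid\theta)}\Big]\Big)\Big]\Big) +\frac{1+r}{1-r}\,\frac{\mathrm{KL}\big(p_T(\cdot\mid\theta^* )\,\|\,p_T(\cdot\mid\bar\theta)\big)}{T}+O\Big(\frac{\log T}{T}\Big),$$ where the constants hidden in $O(\cdot)$ do not depend on $\pi$ or $T$.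
   Context: Setting. Tasks live in $\Theta\subset\mathbb{R}^{d}$; samples live in $\mathbb{R}^{d_z}$; $\|\cdot\|$ is the Euclidean norm and $B(0,R)$ the closed Euclidean ball of radius $R$ centered at $0$. For each $\theta\in\Theta$, $t\ge1$ and $z_{1:t-1}$, $p_t(\cdot\mid z_{1:t-1},\theta)$ is a probability density; the sequence is generated by $z_t\sim p_t(\cdot\mid z_{1:t-1},\theta)$ and $p_T(z_{1:T}\mid\theta)=\prod_{t=1}^T p_t(z_t\mid z_{1:t-1},\theta)$. $\pi$ is a probability density on $\Theta$ (the prior) and $\pi_T(\theta\mid z_{1:T})\propto\pi(\theta)p_T(z_{1:T}\mid\theta)$ is the posterior. For $r\in(0,1)$ the per-sample Rényi divergence is $$D_{r,T}(\theta,\theta^* )=-\frac{1}{T(1-r)}\log\mathbb{E}_{Z\sim p_T(\cdot\mid\theta^* )}\Big[\prod_{t=1}^T\Big(\frac{p_t(z_t\mid z_{1:t-1},\theta)}{p_t(z_t\mid z_{1:t-1},\theta^* )}\Big)^{r}\Big].$$ $\mathrm{KL}$ is the Kullback–Leibler divergence. ''$\mathrm{poly}(x)$'' denotes a quantity bounded by a polynomial in $x$ whose coefficients do not depend on the prior $\pi$ nor on $T$. Assumption (DG). Fix the true task $\theta^*\in\Theta$ and a reference task $\bar\theta\in\Theta$ with $\pi(\bar\theta)>0$. (i) Tails: there is $k\ge1$ such that for all $T\ge1$ and $R\ge T$, with $Z=z_{1:T}\sim p_T(\cdot\mid\theta^* )$: $\mathbb{P}\big(\sup_{\theta:\|\theta\|\ge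 R}p_T(Z\mid\theta)\ge p_T(Z\mid\bar\theta)\big)\le\frac{\mathrm{poly}(T)}{1+R^{1/k}}$ and $\mathbb{P}(\exists t\le T:\|z_t\|\ge R)\le\frac{\mathrm{poly}(T)}{1+R^{1/k}}$. (ii) Moments: for all $T\ge1$, $\mathbb{E}_{Z\sim p_T(\cdot\mid\theta^* )}\big[\log^2\big(\sup_{\theta\in\Theta}\frac{p_T(Z\mid\theta)}{p_T(Z\mid\bar\theta)}\big)\big]\le\mathrm{poly}(T)$. (iii) Regularity: for all $t\ge1$, $R>0$ and $\theta,\theta'\in\Theta\cap B(0,R)$, $\sup_{z_{1:t}\in B(0,R)^t}\log\frac{p_t(z_t\mid z_{1:t-1},\theta)}{p_t(z_t\mid z_{1:t-1},\theta')}\le\mathrm{poly}(R)\|\theta-\theta'\|$. *)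

(* Defs.v *)
From HB Require Import structures.
From mathcomp Require Import all_boot all_order all_algebra.
From mathcomp Require Import all_classical all_reals all_analysis.
Set Implicit Arguments. Unset Strict Implicit. Unset Printing Implicit Defensive.
Import Order.TTheory GRing.Theory Num.Theory.
Local Open Scope classical_set_scope.
Local Open Scope ring_scope.

Section Defs.
Context {R : realType}.

(* Points of R^n are n-tuples of reals (MathComp-Analysis equips n.-tuple T
   with the product sigma-algebra, i.e. the Borel sigma-algebra of R^n). *)
Definition vec (n : nat) := n.-tuple R.

Definition enorm {n : nat} (x : vec n) : R :=
  Num.sqrt (\sum_(i < n) (tnth x i) ^+ 2).

Definition edist {n : nat} (x y : vec n) : R :=
  Num.sqrt (\sum_(i < n) (tnth x i - tnth y i) ^+ 2).

Fixpoint itint (X : Type) (I : (X -> \bar R) -> \bar R) (n : nat)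
  : (n.-tuple X -> \bar R) -> \bar R :=
  match n return (n.-tuple X -> \bar R) -> \bar R with
  | 0 => fun f => f [tuple]
  | m.+1 => fun f => I (fun x => itint I (fun t : m.-tuple X => f [tuple of x :: t]))
  end.

Definition lebR (f : R -> \bar R) : \bar R :=
  (\int[@lebesgue_measure R]_x f x)%E.

(* Lebesgue integral of a nonnegative function on R^n, computed as the
   iterated integral (equal to the n-dimensional Lebesgue integral for
   nonnegative measurable f by Tonelli). *)
Definition leb (n : nat) (f : vec n -> \bar R) : \bar R := itint lebR f.

(* Signed integral: integral of positive part minus integral of negative part
   (same convention as the library's \int). *)
Definition sint (X : Type) (I : (X -> \bar R) -> \bar R) (g : X -> \bar R)
  : \bar R :=
  (I (fun x => maxe (g x) 0) - I (fun x => maxe (- g x) 0))%E.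

Definition elogratio (a b : R) : \bar R :=
  if (0 < a) && (0 < b) then (ln (a / b))%:E
  else if 0 < a then +oo%E
  else if 0 < b then -oo%E
  else 0%E.

Section Model.
Variables (d dz : nat).
Local Notation V := (vec dz).
Local Notation P := (vec d).

(* Conditional density model: [p hist z th] is p_t(z | z_{1:t-1}, th) where
   hist = z_{1:t-1} (so t = size hist + 1). *)
Variable p : seq V -> V -> P -> R.

Definition pT (T : nat) (zs : T.-tuple V) (th : P) : R :=
  \prod_(t < T) p (take t zs) (tnth zs t) th.

Definition lebZ (T : nat) (f : T.-tuple V -> \bar R) : \bar R :=
  itint (@leb dz) f.

Definition EZ (th0 : P) (T : nat) (g : T.-tuple V -> \bar R) : \bar R :=
  sint (@lebZ T) (fun zs => ((pT zs th0)%:E * g zs)%E).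

Definition PZ (th0 : P) (T : nat) (A : T.-tuple V -> Prop) : \bar R :=
  EZ th0 (fun zs => (\1_A zs)%:E).

Definition KLT (T : nat) (th1 th2 : P) : \bar R :=
  EZ th1 (fun zs : T.-tuple V => elogratio (pT zs th1) (pT zs th2)).

Definition renyi (r : R) (T : nat) (th th0 : P) : \bar R :=
  (- ((T%:R * (1 - r))^-1)%:E *
    lne (EZ th0 (fun zs : T.-tuple V =>
      (\prod_(t < T) ((p (take t zs) (tnth zs t) th /
                       p (take t zs) (tnth zs t) th0) `^ r))%:E)))%E.

Definition intTheta (Theta : set P) (h : P -> \bar R) : \bar R :=
  sint (@leb d) (fun th => if th \in Theta then h th else 0%E).

(* Posterior expectation E_{th ~ pi_T(. | zs)} [h th]; the posterior is
   pi(th) p_T(zs|th) / N(zs); if the normaliser N(zs) is not in (0,+oo) the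
   posterior is undefined and we use the (conservative) value +oo. *)
Definition postE (Theta : set P) (prior : P -> R) (T : nat) (zs : T.-tuple V)
  (h : P -> \bar R) : \bar R :=
  let N := intTheta Theta (fun th => (prior th * pT zs th)%:E) in
  if ((0 < N) && (N < +oo))%E then
    (intTheta Theta (fun th => ((prior th * pT zs th)%:E * h th)%E)
      * ((fine N)^-1)%:E)%E
  else +oo%E.

Definition polyb (c : R) (m : nat) (x : R) : R := c * (1 + x) ^+ m.

Definition DG (Theta : set P) (ths thb : P) : Prop :=
  (exists (k : R) (c : R) (m : nat), 1 <= k /\
     forall (T : nat) (Rr : R), (1 <= T)%N -> T%:R <= Rr ->
       (PZ ths (fun zs : T.-tuple V =>
          (ereal_sup [set (pT zs th)%:E | th in [set th | Theta th /\ (Rr <= enorm th)%R]]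
             >= (pT zs thb)%:E)%E)
        <= (polyb c m T%:R / (1 + Rr `^ (k^-1)))%:E)%E /\
       (PZ ths (fun zs : T.-tuple V =>
          exists t : 'I_T, (Rr <= enorm (tnth zs t))%R)
        <= (polyb c m T%:R / (1 + Rr `^ (k^-1)))%:E)%E) /\
  (exists (c : R) (m : nat), forall T : nat, (1 <= T)%N ->
     (EZ ths (fun zs : T.-tuple V =>
        let S := ereal_sup [set elogratio (pT zs th) (pT zs thb) | th in Theta] in
        S * S) <= (polyb c m T%:R)%:E)%E) /\
  (exists (c : R) (m : nat), forall (t : nat) (Rr : R) (th th' : P),
     (1 <= t)%N -> 0 < Rr ->
     Theta th -> enorm th <= Rr -> Theta th' -> enorm th' <= Rr ->
     forall (hist : (t.-1).-tuple V) (z : V),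
       (forall i, enorm (tnth hist i) <= Rr) -> enorm z <= Rr ->
       (elogratio (p hist z th) (p hist z th')
          <= (polyb c m Rr * edist th th')%:E)%E).

End Model.
End Defs.

(* Main.v *)
Require Import Defs.
From HB Require Import structures.
From mathcomp Require Import all_boot all_order all_algebra.
From mathcomp Require Import all_classical all_reals all_analysis.
From mathcomp Require Import measurable_realfun ring lra.
Import Order.TTheory GRing.Theory Num.Theory.
Local Open Scope classical_set_scope.
Local Open Scope ring_scope.

(** Write [s], [q] and [P y] for the densities of the data under the true task,
the reference task and the task [y], [n] for the evidence (the mixture of the
[P y] under the prior), [w = P y / n] for the posterior weight and
[D y = - ln (int s^(1-r) (P y)^r)] for the unnormalised Rényi divergence.

By regularity all tasks have the same support, so [D] is finite and
[E exp (r ln (P y / s) + D y) = 1].  When the task and the data both lie in a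
ball of radius [R], a finite grid of polynomial size in [R] turns this identity into
[D y <= U + r ln (s / P y)] with [E U = O(log #grid)].  Elsewhere the
Fenchel-Young inequality [w h <= w ln w - w + e^h] is used instead, and
[ln w = ln (P y / q) + ln (q / s) + ln (s / n)] is controlled on that region by
the tail and moment assumptions once [R] is a large power of [T].  Since
[w ln (1 / w) <= 1 - w], both cases leave
[w D <= w (O(log T) + (1 + r) (ln (s / n))^+ + tail) + (P y / s)^r e^(D y) + r],
and the Gibbs variational principle bounds [E (ln (s / n))^+] by the
Kullback-Leibler term plus the prior-mass term of the theorem. *)

(** * Iterated integrals as integrals *)

(** Fenchel-Young alone is too weak: it leaves the posterior mean of [ln (P y / s)], which the
    moment assumption bounds only by a polynomial in [T], far above [log T]. A finite cover replaces
    this mean by a sum over fixed competitors, whose logarithm costs only [ln #grid]. Outside the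
    ball no such cover is at hand, but there [w ln w] is affordable: [ln (P y / q)] lies below one
    square-integrable supremum over all tasks, and its contribution is positive only on rare events.

    The second obstacle is measurability. Expectations are given as iterated integrals, and neither
    the supremum in the moment condition nor the posterior risk is known to be measurable. Iterated
    integrals are therefore used mainly through monotonicity and through their agreement with an
    integral on measurable nonnegative functions, and bounds are passed on as measurable majorants.
    These equal [+oo] where the true density is positive and the evidence infinite, in accordance
    with the convention of [postE]. *)

Section SigmaFiniteCopy.
Context {R : realType} d (T : measurableType d) (m : {measure set T -> \bar R}).

(** An alias of [m] on which the sigma-finite structure can be declared: for a pushforward,
    sigma-finiteness is available only as a proposition, whereas Tonelli asks for the structure. *)
Definition sigma_finite_copy (_ : sigma_finite setT m) : set T -> \bar R := m.

Variable sm : sigma_finite setT m.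
HB.instance Definition _ := Measure.copy (sigma_finite_copy sm) m.
HB.instance Definition _ :=
  @Measure_isSigmaFinite.Build _ _ _ (sigma_finite_copy sm) sm.
End SigmaFiniteCopy.

Section IteratedIntegrals.
Set Implicit Arguments.
Unset Strict Implicit.
Context {R : realType}.
Local Open Scope ereal_scope.

(** No measurability is required: the integral of a nonnegative function is a supremum over the
    simple functions below it, and this family grows with the function. *)
Lemma ge0_le_integralT d (T : measurableType d)
    (mu : {measure set T -> \bar R}) (f g : T -> \bar R) :
  (forall x, 0 <= f x) -> (forall x, f x <= g x) ->
  \int[mu]_x f x <= \int[mu]_x g x.
Proof.
move=> f0 fg; have g0 x : 0 <= g x by exact: le_trans (fg x).
rewrite !ge0_integralTE//; apply: le_ereal_sup => _ [h hf <-].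
by exists h => // x; exact: le_trans (fg x).
Qed.

Definition monotone_functional X (I : (X -> \bar R) -> \bar R) :=
  forall f g : X -> \bar R,
    (forall x, 0 <= f x) -> (forall x, f x <= g x) -> I f <= I g.

(** Restricted to measurable functions because an iterated integral of a non-measurable function
    need not agree with the integral; beyond them one falls back on [monotone_functional]. *)
Definition represents d (X : measurableType d)
    (I : (X -> \bar R) -> \bar R) (mu : set X -> \bar R) :=
  forall f : X -> \bar R, measurable_fun setT f -> (forall x, 0 <= f x) ->
    I f = \int[mu]_x f x.

Lemma represents_ge0 d (X : measurableType d) (I : (X -> \bar R) -> \bar R)
    (mu : {measure set X -> \bar R}) f :
  monotone_functional I -> represents I mu -> (forall x, 0 <= f x) -> 0 <= I f.
Proof.
move=> mI rI f0; have := mI (cst 0) f (fun=> lexx 0) f0.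
by rewrite rI// integral0.
Qed.

Lemma monotone_itint d (X : measurableType d) (I : (X -> \bar R) -> \bar R)
    (mu : {measure set X -> \bar R}) n :
  monotone_functional I -> represents I mu ->
  monotone_functional (@itint R X I n).
Proof.
(* Nonnegativity joins the induction because [mI] applies only when the inner iterated integral is
   known to be nonnegative. *)
move=> mI rI; suff: forall f g : n.-tuple X -> \bar R,
    (forall x, 0 <= f x) -> (forall x, f x <= g x) ->
    0 <= itint I f /\ itint I f <= itint I g.
  by move=> H f g f0 fg; have [] := H f g f0 fg.
elim: n => [|n IH] f g f0 fg /=; first by split.
have IHx x := IH _ _ (fun t => f0 [tuple of x :: t]) (fun t => fg [tuple of x :: t]).
split; first by apply: represents_ge0 rI _ => // x; exact: (IHx x).1.
by apply: mI => x; have [] := IHx x.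
Qed.

(** The measure on [n.+1]-tuples is the image under cons of the product of [mu] with the measure on
    [n]-tuples, and Tonelli unfolds its integral into the iterated one. Sigma-finiteness belongs to
    the conclusion because the next application of Tonelli needs it. *)
Lemma itint_represented d (X : measurableType d) (I : (X -> \bar R) -> \bar R)
    (mu : {sigma_finite_measure set X -> \bar R}) n :
  represents I mu ->
  exists nu : {sigma_finite_measure set (n.-tuple X) -> \bar R},
    represents (@itint R X I n) nu.
Proof.
move=> rI; elim: n => [|n [nu IH]].
  exists (\d_([tuple] : 0.-tuple X)) => f mf f0 /=.
  by rewrite integral_dirac// diracT mul1e.
pose phi (x : X * n.-tuple X) : n.+1.-tuple X := [tuple of x.1 :: x.2].
pose psi (t : n.+1.-tuple X) : X * n.-tuple X := (thead t, [tuple of behead t]).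
have mphi : measurable_fun setT phi.
  exact: (@measurable_cons _ _ _ _ fst n snd).
have mpsi : measurable_fun setT psi.
  by apply: measurable_fun_pair; [exact: measurable_tnth|exact: measurable_behead].
have phiK : cancel phi psi.
  by case=> x t; rewrite /psi /phi theadE; congr pair; exact: val_inj.
pose m := pushforward (mu \x nu) phi.
have sm : sigma_finite setT m.
  have /sigma_finiteP[F [TF ndF Foo]] := sigma_finiteT mu.
  have /sigma_finiteP[G [TG ndG Goo]] := sigma_finiteT nu.
  (* Both exhaustions are nondecreasing, so the diagonal rectangles already cover: coordinates
     caught at stages [i] and [j] are both caught at stage [maxn i j]. *)
  exists (fun i => psi @^-1` (F i `*` G i)).
    apply/esym; rewrite -subTset => t _.
    have [i _ Fi] : (\bigcup_i F i) (psi t).1 by rewrite -TF.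
    have [j _ Gj] : (\bigcup_i G i) (psi t).2 by rewrite -TG.
    exists (maxn i j) => //; split.
    - by move: Fi; exact/subsetPset/ndF/leq_maxl.
    - by move: Gj; exact/subsetPset/ndG/leq_maxr.
  move=> i; have [mF Fi] := Foo i; have [mG Gi] := Goo i; split.
    by rewrite -[_ @^-1` _]setTI; apply: mpsi => //; exact: measurableX.
  rewrite /m /pushforward -comp_preimage (_ : psi \o phi = id); last exact/funext.
  by rewrite preimage_id product_measure1E// lte_mul_pinfty// ge0_fin_numE.
exists (@sigma_finite_copy _ _ _
  (measure_function_pushforward__canonical__measure_function_Measure (mu \x nu) mphi) sm).
move=> f mf f0 /=.
have mfphi : measurable_fun setT (f \o phi) by exact: measurableT_comp.
rewrite /sigma_finite_copy/= -/m.
have mfx x : measurable_fun setT (fun t : n.-tuple X => f [tuple of x :: t]).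
  exact: (@measurableT_comp _ _ _ _ _ _ (f \o phi) setT (pair x) mfphi
    (pair1_measurable x)).
rewrite (ge0_integral_pushforward mphi)// preimage_setT.
rewrite (@fubini_tonelli1 _ _ _ _ _ mu nu (f \o phi) mfphi) /=; last first.
  by move=> x; exact: f0.
have E : (fun x => itint I (fun t => f [tuple of x :: t])) = fubini_F nu (f \o phi).
  by apply/funext => x; rewrite /fubini_F /= IH.
rewrite E rI//; first by apply: measurable_fun_fubini_tonelli_F => // x; exact: f0.
by move=> x; apply: integral_ge0 => t _; exact: f0.
Qed.

Lemma monotone_lebR : monotone_functional (@lebR R).
Proof.
by move=> f g f0 fg; exact: (@ge0_le_integralT _ (measurableTypeR R) lebesgue_measure f g).
Qed.

(* The measurable structure carried by [R] has another display than the one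
   [lebesgue_measure] lives on, hence the transport along the identity. *)
Lemma lebR_represented :
  exists nu : {sigma_finite_measure set R -> \bar R}, represents (@lebR R) nu.
Proof.
have mid : measurable_fun setT (idfun : measurableTypeR R -> R) by move=> _ Y; rewrite setTI.
pose m := measure_function_pushforward__canonical__measure_function_Measure
  (@lebesgue_measure R) mid.
have sm : sigma_finite setT m.
  have [F FT Foo] := @sigma_finiteT _ _ _ (@lebesgue_measure R).
  by exists F.
exists (@sigma_finite_copy _ _ _ m sm) => f mf f0.
by rewrite /sigma_finite_copy/= (ge0_integral_pushforward mid).
Qed.

Lemma leb_represented n :
  exists nu : {sigma_finite_measure set (vec n) -> \bar R},
    represents (@leb R n) nu.
Proof. by have [mu rmu] := lebR_represented; exact: itint_represented rmu. Qed.

Lemma monotone_leb n : monotone_functional (@leb R n).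
Proof.
have [mu rmu] := lebR_represented.
exact: (monotone_itint monotone_lebR rmu).
Qed.

Lemma lebZ_represented dz T :
  exists nu : {sigma_finite_measure set (T.-tuple (vec dz)) -> \bar R},
    represents (@lebZ R dz T) nu.
Proof. by have [mu rmu] := leb_represented dz; exact: itint_represented rmu. Qed.

Lemma monotone_lebZ dz T : monotone_functional (@lebZ R dz T).
Proof.
have [mu rmu] := leb_represented dz.
exact: (monotone_itint (@monotone_leb dz) rmu).
Qed.

End IteratedIntegrals.

(** * Scalar inequalities for logarithms and exponentials *)

Section RealInequalities.
Set Implicit Arguments.
Unset Strict Implicit.
Context {R : realType}.
Implicit Types x y p q n : R.

Lemma ln_le_subr1 x : 0 < x -> ln x <= x - 1.
Proof.
by move=> x0; have := @le_ln1Dx R (x - 1); rewrite addrCA subrr addr0; apply; lra.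
Qed.

Lemma lnV_lesub x y : 0 < x -> 0 < y -> ln (x / y) = ln x - ln y.
Proof. by move=> x0 y0; rewrite lnM ?posrE ?invr_gt0// lnV ?posrE. Qed.

(** Conjugacy of [x ln x - x] and [expR]: this is [ln y <= y - 1] at [y = expR h / x], multiplied by
    [x]. *)
Lemma fenchel_expR x h : 0 < x -> x * h <= x * ln x - x + expR h.
Proof.
move=> x0; have e0 := expR_gt0 h.
have := ln_le_subr1 (divr_gt0 e0 x0).
rewrite lnV_lesub// expRK => /(ler_wpM2l (ltW x0)).
rewrite (_ : x * (expR h / x - 1) = expR h - x); last by field; lra.
lra.
Qed.

(* The posterior weight of a task is [w = p / n]; it tilts the log-loss [d]. *)
Lemma tilted_logloss_le (r p s q n d u : R) (b : bool) :
  0 <= r -> 0 < p -> 0 < s -> 0 < q -> 0 < n -> 0 <= u ->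
  (~~ b -> d <= u + r * ln (s / p)) ->
  p / n * d <= p / n * (u + q / s + (1 + r) * Num.max (ln (s / n)) 0)
    + (if b then p / n * Num.max (ln (p / q)) 0 else 0)
    + expR (r * ln (p / s) + d) + r.
Proof.
move=> r0 p0 s0 q0 n0 u0 hb.
have w0 : 0 < p / n by exact: divr_gt0.
set w := p / n in w0 *; set L := Num.max (ln (s / n)) 0.
set l := Num.max (ln (p / q)) 0; set h := r * ln (p / s) + d.
have L0 : 0 <= L by rewrite /L le_max lexx orbT.
have l0 : 0 <= l by rewrite /l le_max lexx orbT.
have LE : ln (s / n) <= L by rewrite /L le_max lexx.
have lE : ln (p / q) <= l by rewrite /l le_max lexx.
have qs0 : 0 < q / s by exact: divr_gt0.
have qsE := ln_le_subr1 qs0.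
have e0 := expR_ge0 h.
(* relative entropy is nonnegative: w ln (1/w) <= 1 - w *)
have entropy : w * (ln (s / p)) <= w * L + 1.
  have := fenchel_expR 0 w0; rewrite expR0 mulr0 => H.
  rewrite lnV_lesub//; have : w * ln (s / n) <= w * L by apply: ler_wpM2l => //; lra.
  move: H; rewrite /w !lnV_lesub// -/w; lra.
(* This [r * (w * L)] occurs in both cases; in the Fenchel-Young case [w * ln w] contributes another
   [w * L], which is where the factor [1 + r] comes from. *)
have wr : w * (r * ln (s / p)) <= r * (w * L) + r.
  rewrite mulrCA; have := ler_wpM2l r0 entropy; lra.
have wL0 : 0 <= w * L by apply: mulr_ge0 => //; lra.
have wl0 : 0 <= w * l by apply: mulr_ge0 => //; lra.
have wq0 : 0 <= w * (q / s) by apply: mulr_ge0 => //; lra.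
have wu0 : 0 <= w * u by apply: mulr_ge0 => //; lra.
case: b hb => [_|/(_ isT) hd].
  have := fenchel_expR h w0.
  have : w * ln w <= w * l + w * (q / s) + w * L.
    rewrite -!mulrDr; apply: ler_wpM2l; first lra.
    move: LE lE qsE; rewrite /w !lnV_lesub//; lra.
  have -> : w * h = w * d - w * (r * ln (s / p)).
    by rewrite /h !lnV_lesub//; ring.
  lra.
have := ler_wpM2l (ltW w0) hd; lra.
Qed.

(* Gibbs variational principle in pointwise form. *)
Lemma tilted_evidence_le (s q p n c : R) : 0 < s -> 0 < q -> 0 < p -> 0 < n ->
  Num.max (ln (s / n)) 0 <= n / s + ln (s / q) - ln (p / q) - c + p / n * expR c.
Proof.
move=> s0 q0 p0 n0.
have H : ln (s / n) <= ln (s / q) - ln (p / q) - c + p / n * expR c.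
  have pn0 := divr_gt0 p0 n0.
  have := ln_le_subr1 (mulr_gt0 pn0 (expR_gt0 c)).
  rewrite [ln (_ * expR _)]lnM ?posrE ?expR_gt0// expRK !lnV_lesub//; lra.
(* The positive part costs [n / s]: by [K] and [H] the right-hand side is at least
   [n / s + ln (s / n) >= 0]. Against [s] this term integrates to the total evidence. *)
have K : - ln (s / n) <= n / s.
  have := ln_le_subr1 (divr_gt0 n0 s0); rewrite !lnV_lesub//; lra.
have ns0 : 0 < n / s by exact: divr_gt0.
by rewrite ge_max; apply/andP; split; lra.
Qed.

Lemma powR_le_affine (r x : R) : 0 < r < 1 -> 0 <= x -> x `^ r <= 1 - r + r * x.
Proof.
move=> /andP[r0 r1] x0; have r1' : 0 < 1 - r by lra.
have := @conjugate_powR R (x `^ r) 1 r^-1 (1 - r)^-1 (powR_ge0 _ _) ler01.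
rewrite !invr_gt0 !invrK mulr1 -powRrM mulfV ?gt_eqF// powRr1// powR1 mul1r.
by move=> /(_ r0 r1')/(_ _)/le_trans; apply; lra.
Qed.
End RealInequalities.

(** * Measurability, Tonelli and positivity of integrals *)

Section MeasureTools.
Set Implicit Arguments.
Unset Strict Implicit.
Context {R : realType}.

Lemma measurable_invr : measurable_fun [set: R] (fun x : R => x^-1).
Proof.
(* A real power of [x ^+ 2] expresses the inverse on the whole line, including 0, where both sides
   vanish because [0^-1 = 0]. *)
rewrite (_ : (fun x => x^-1) = (fun x : R => x * (x ^+ 2) `^ (-1))); last first.
  apply/funext => x; rewrite powR_inv1 ?sqr_ge0//.
  have [->|x0] := eqVneq x 0; first by rewrite invr0 mul0r.
  by rewrite expr2 invfM mulrA mulfV// mul1r.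
apply: measurable_funM => //; apply: (measurableT_comp (measurable_powR _)).
exact: exprn_measurable.
Qed.

Lemma measurable_funV d (T : measurableType d) (f : T -> R) :
  measurable_fun setT f -> measurable_fun setT (fun x => (f x)^-1).
Proof. by move=> mf; exact: (measurableT_comp measurable_invr mf). Qed.

Lemma measurable_fun_div d (T : measurableType d) (f g : T -> R) :
  measurable_fun setT f -> measurable_fun setT g ->
  measurable_fun setT (fun x => f x / g x).
Proof. by move=> mf mg; apply: measurable_funM => //; exact: measurable_funV. Qed.

Lemma measurable_fun_ln d (T : measurableType d) (f : T -> R) :
  measurable_fun setT f -> measurable_fun setT (fun x => ln (f x)).
Proof. by move=> mf; apply: (measurableT_comp (@measurable_ln R) mf). Qed.

Lemma measurable_fun_expR d (T : measurableType d) (f : T -> R) :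
  measurable_fun setT f -> measurable_fun setT (fun x => expR (f x)).
Proof. by move=> mf; apply: (measurableT_comp (@measurable_expR R) mf). Qed.

Context dX dY (X : measurableType dX) (Y : measurableType dY).

Lemma measurable_integral2 (nu : {sigma_finite_measure set Y -> \bar R})
    (f : X -> Y -> \bar R) :
  measurable_fun setT (fun z : X * Y => f z.1 z.2) ->
  (forall x y, 0 <= f x y)%E ->
  measurable_fun setT (fun x => \int[nu]_y f x y)%E.
Proof.
move=> mf f0.
exact: (@measurable_fun_fubini_tonelli_F _ _ _ _ _ nu (fun z => f z.1 z.2)).
Qed.

Lemma measurable_integral1 (mu : {sigma_finite_measure set X -> \bar R})
    (f : X -> Y -> \bar R) :
  measurable_fun setT (fun z : X * Y => f z.1 z.2) ->
  (forall x y, 0 <= f x y)%E ->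
  measurable_fun setT (fun y => \int[mu]_x f x y)%E.
Proof.
move=> mf f0.
exact: (@measurable_fun_fubini_tonelli_G _ _ _ _ _ mu (fun z => f z.1 z.2)).
Qed.

Lemma integral_swap (mu : {sigma_finite_measure set X -> \bar R})
    (nu : {sigma_finite_measure set Y -> \bar R}) (f : X -> Y -> \bar R) :
  measurable_fun setT (fun z : X * Y => f z.1 z.2) ->
  (forall x y, 0 <= f x y)%E ->
  (\int[mu]_x \int[nu]_y f x y = \int[nu]_y \int[mu]_x f x y)%E.
Proof. by move=> mf f0; exact: (@fubini_tonelli _ _ _ _ _ mu nu (fun z => f z.1 z.2)). Qed.

Lemma measurable_section1 d (Z : measurableType d) (f : X -> Y -> Z) (x : X) :
  measurable_fun setT (fun z : X * Y => f z.1 z.2) -> measurable_fun setT (f x).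
Proof. by move=> mf; exact: (measurableT_comp mf (pair1_measurable x)). Qed.

Lemma measurable_section2 d (Z : measurableType d) (f : X -> Y -> Z) (y : Y) :
  measurable_fun setT (fun z : X * Y => f z.1 z.2) -> measurable_fun setT (f ^~ y).
Proof. by move=> mf; exact: (measurableT_comp mf (pair2_measurable y)). Qed.

(** By contraposition: a vanishing integral makes [g], hence also [f], zero almost everywhere. *)
Lemma integral_gt0_support (mu : {measure set X -> \bar R}) (f g : X -> R) :
  measurable_fun setT f -> measurable_fun setT g ->
  (forall x, 0 <= f x) -> (forall x, 0 <= g x) ->
  (forall x, 0 < f x -> 0 < g x) ->
  (0 < \int[mu]_x (f x)%:E)%E -> (0 < \int[mu]_x (g x)%:E)%E.
Proof.
move=> mf mg f0 g0 fg; apply: contraPT; rewrite -leNgt => gle0.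
have g00 : (\int[mu]_x `|(g x)%:E| = 0)%E.
  under eq_integral do rewrite gee0_abs ?lee_fin//.
  by apply/eqP; rewrite eq_le gle0 integral_ge0// => x _; rewrite lee_fin.
have aeg : ae_eq mu setT (EFin \o g) (cst 0%E).
  by apply/ae_eq_integral_abs => //; exact/measurable_EFinP.
have aef : ae_eq mu setT (EFin \o f) (cst 0%E).
  apply: filterS aeg => x /(_ I)/= [gx0] _; congr EFin.
  apply/eqP; move: (f0 x); rewrite le_eqVlt => /orP[/eqP <-//|/fg].
  by rewrite gx0 ltxx.
apply/negP; rewrite -leNgt (@ae_eq_integral _ _ _ _ _ (cst 0%E) (EFin \o f))//.
  by rewrite integral0.
exact/measurable_EFinP.
Qed.

(** Measurability and nonnegativity of the sum are returned as well, so that the lemma can be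
    chained over longer sums. *)
Lemma ge0_integralTD (mu : {measure set X -> \bar R}) (f g : X -> \bar R) :
  measurable_fun setT f -> measurable_fun setT g ->
  (forall x, 0 <= f x)%E -> (forall x, 0 <= g x)%E ->
  [/\ measurable_fun setT (fun x => f x + g x)%E, (forall x, 0 <= f x + g x)%E &
   (\int[mu]_x (f x + g x) = \int[mu]_x f x + \int[mu]_x g x)%E].
Proof.
move=> mf mg f0 g0; split; [exact: emeasurable_funD|by move=> x; exact: adde_ge0|].
exact: ge0_integralD.
Qed.

End MeasureTools.

(** * Posterior risk and evidence *)

Section Posterior.
Set Implicit Arguments.
Unset Strict Implicit.
Context {R : realType} dX dY (X : measurableType dX) (Y : measurableType dY).
Variables (mu : {sigma_finite_measure set X -> \bar R}).
Variables (nu : {sigma_finite_measure set Y -> \bar R}).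
Variables (P : X -> Y -> R) (s q : X -> R) (pi : Y -> R).
Hypotheses (mP : measurable_fun setT (fun z : X * Y => P z.1 z.2))
  (ms : measurable_fun setT s) (mq : measurable_fun setT q)
  (mpi : measurable_fun setT pi).
Hypotheses (P0 : forall x y, 0 <= P x y) (s0 : forall x, 0 <= s x)
  (q0 : forall x, 0 <= q x) (pi0 : forall y, 0 <= pi y).
Hypotheses (P_gt0 : forall x y, 0 < s x -> 0 < P x y)
  (q_gt0 : forall x, 0 < s x -> 0 < q x).
Hypotheses (intP : forall y, (\int[mu]_x (P x y)%:E <= 1)%E)
  (ints : (\int[mu]_x (s x)%:E = 1)%E) (intq : (\int[mu]_x (q x)%:E <= 1)%E)
  (intpi : (\int[nu]_y (pi y)%:E = 1)%E).

Definition evidence x : \bar R := (\int[nu]_y (pi y * P x y)%:E)%E.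
Let n x := fine (evidence x).

(** Log-loss regret of the prior mixture against the true density. The positive part keeps its
    integrals in [[0, +oo]]. At infinite evidence [n x] is 0, so the value is the default 0; such
    points are charged to a separate function [G]. *)
Definition mixture_loss x := Num.max (ln (s x / n x)) 0.

Let mpiP : measurable_fun setT (fun z : X * Y => pi z.2 * P z.1 z.2).
Proof. by apply: measurable_funM => //; apply: measurableT_comp. Qed.

Let mPx x : measurable_fun setT (P x). Proof. exact: measurable_section1. Qed.

Lemma evidence_ge0 x : (0 <= evidence x)%E.
Proof. by apply: integral_ge0 => y _; rewrite lee_fin mulr_ge0. Qed.

Lemma evidence_gt0 x : 0 < s x -> (0 < evidence x)%E.
Proof.
move=> sx; apply: (@integral_gt0_support R _ _ nu pi) => //.
- exact: measurable_funM.
- by move=> y; rewrite mulr_ge0.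
- by move=> y piy; rewrite mulr_gt0// P_gt0.
- by rewrite intpi lte01.
Qed.

Lemma measurable_evidence : measurable_fun setT evidence.
Proof.
apply: (@measurable_integral2 R _ _ _ _ nu (fun x y => (pi y * P x y)%:E)).
  exact/measurable_EFinP.
by move=> x y; rewrite lee_fin mulr_ge0.
Qed.

Let mn : measurable_fun setT n.
Proof. by apply: measurableT_comp => //; exact: measurable_evidence. Qed.

Let n0 x : 0 <= n x. Proof. by rewrite fine_ge0// evidence_ge0. Qed.

Let nE x : (evidence x < +oo)%E -> (n x)%:E = evidence x.
Proof. by move=> h; rewrite fineK// ge0_fin_numE// evidence_ge0. Qed.

Let n_gt0 x : 0 < s x -> (evidence x < +oo)%E -> 0 < n x.
Proof. by move=> sx h; rewrite -lte_fin nE// evidence_gt0. Qed.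

Lemma mixture_loss_ge0 x : 0 <= mixture_loss x.
Proof. by rewrite le_max lexx orbT. Qed.

Lemma measurable_mixture_loss : measurable_fun setT mixture_loss.
Proof. by apply: measurable_maxr => //; apply/measurable_fun_ln/measurable_fun_div. Qed.

Lemma integral_evidence_le : (\int[mu]_x evidence x <= 1)%E.
Proof.
rewrite (@integral_swap R _ _ _ _ mu nu (fun x y => (pi y * P x y)%:E)); first last.
- by move=> x y; rewrite lee_fin mulr_ge0.
- exact/measurable_EFinP.
rewrite -intpi; apply: ge0_le_integralT => [y|y].
  by apply: integral_ge0 => x _; rewrite lee_fin mulr_ge0.
under eq_integral do rewrite EFinM.
rewrite ge0_integralZl//.
- by rewrite -[leRHS]mule1; apply: lee_wpmul2l; rewrite ?lee_fin.
- by apply/measurable_EFinP; exact: measurable_section2.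
- by move=> x _; rewrite lee_fin.
- by rewrite lee_fin.
Qed.

(** * Posterior average of the divergence *)

Section Risk.
Variables (r u g : R) (b : X -> Y -> bool) (D : Y -> R) (U : X -> R) (G : X -> \bar R).
Hypotheses (r0 : 0 <= r) (mb : measurable_fun setT (fun z : X * Y => b z.1 z.2))
  (mD : measurable_fun setT D) (D0 : forall y, 0 <= D y)
  (mU : measurable_fun setT U) (U0 : forall x, 0 <= U x)
  (mG : measurable_fun setT G) (G0 : forall x, (0 <= G x)%E).
Hypotheses
  (D_le : forall x y, 0 < s x -> ~~ b x y -> D y <= U x + r * ln (s x / P x y))
  (D_normalized : forall y,
    (\int[mu]_x (s x * expR (r * ln (P x y / s x) + D y))%:E <= 1)%E)
  (G_ge : forall x, 0 < s x -> (evidence x < +oo)%E ->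
    (\int[nu]_y (pi y * (if b x y then P x y / n x * Num.max (ln (P x y / q x)) 0
                         else 0))%:E <= G x)%E)
  (G_oo : forall x, 0 < s x -> evidence x = +oo%E -> G x = +oo%E)
  (intU : (\int[mu]_x (s x * U x)%:E <= u%:E)%E)
  (intG : (\int[mu]_x ((s x)%:E * G x) <= g%:E)%E).

Let H x : \bar R := (\int[nu]_y (pi y * expR (r * ln (P x y / s x) + D y))%:E)%E.

Let mPs : measurable_fun setT (fun z : X * Y => expR (r * ln (P z.1 z.2 / s z.1) + D z.2)).
Proof.
apply: measurable_fun_expR; apply: measurable_funD.
  apply: measurable_funM => //; apply: measurable_fun_ln.
  by apply: measurable_fun_div => //; apply: measurableT_comp.
by apply: measurableT_comp.
Qed.

Let mPs1 x : measurable_fun setT (fun y => expR (r * ln (P x y / s x) + D y)).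
Proof.
exact: (@measurable_section1 _ _ _ _ _ _
  (fun x y => expR (r * ln (P x y / s x) + D y)) x mPs).
Qed.

Let mPs2 y : measurable_fun setT (fun x => expR (r * ln (P x y / s x) + D y)).
Proof.
exact: (@measurable_section2 _ _ _ _ _ _
  (fun x y => expR (r * ln (P x y / s x) + D y)) y mPs).
Qed.

Let H0 x : (0 <= H x)%E.
Proof. by apply: integral_ge0 => y _; rewrite lee_fin mulr_ge0// expR_ge0. Qed.

Let mH : measurable_fun setT H.
Proof.
apply: (@measurable_integral2 R _ _ _ _ nu
  (fun x y => (pi y * expR (r * ln (P x y / s x) + D y))%:E)).
  by apply/measurable_EFinP; apply: measurable_funM => //; apply: measurableT_comp.
by move=> x y; rewrite lee_fin mulr_ge0// expR_ge0.
Qed.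

(** [tilted_logloss_le] averaged over the prior. The posterior weights [pi y * P x y / n x] have
    total mass one, so a factor free of [y] comes out unchanged; the weighted logarithms go to [G]
    and the exponentials to [H]. *)
Lemma posterior_risk_le x : 0 < s x -> (evidence x < +oo)%E ->
  (\int[nu]_y (pi y * P x y * D y)%:E * ((n x)^-1)%:E <=
   (U x + q x / s x + (1 + r) * mixture_loss x + r)%:E + G x + H x)%E.
Proof.
move=> sx Nx; have nx := n_gt0 sx Nx; have qx := q_gt0 sx.
set a := U x + q x / s x + (1 + r) * mixture_loss x.
have a0 : 0 <= a.
  apply: addr_ge0; first by rewrite addr_ge0// divr_ge0.
  by apply: mulr_ge0; [rewrite addr_ge0|exact: mixture_loss_ge0].
set l := fun y => if b x y then P x y / n x * Num.max (ln (P x y / q x)) 0 else 0.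
have l0 y : 0 <= l y.
  by rewrite /l; case: ifP => // _; rewrite mulr_ge0 ?divr_ge0// le_max lexx orbT.
have ml : measurable_fun setT l.
  apply: measurable_fun_ifT => //; first exact: measurable_section1.
  apply: measurable_funM; first exact: measurable_fun_div.
  by apply: measurable_maxr => //; apply/measurable_fun_ln/measurable_fun_div.
set e := fun y => expR (r * ln (P x y / s x) + D y).
have e0 y : 0 <= e y by exact: expR_ge0.
have me : measurable_fun setT e by exact: mPs1.
rewrite -ge0_integralZr//; last 3 first.
- by apply/measurable_EFinP; do 2 apply: measurable_funM => //.
- by move=> y _; rewrite lee_fin !mulr_ge0.
- by rewrite lee_fin invr_ge0.
apply: (@le_trans _ _ (\int[nu]_y ((a / n x)%:E * (pi y * P x y)%:E
   + (pi y * l y)%:E + (pi y * e y)%:E + r%:E * (pi y)%:E))%E).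
  apply: ge0_le_integralT => y.
    by rewrite -EFinM lee_fin !mulr_ge0// invr_ge0.
  rewrite -!EFinM -!EFinD lee_fin.
  have Px := P_gt0 y sx.
  have := @tilted_logloss_le R r (P x y) (s x) (q x) (n x) (D y) (U x) (b x y)
    r0 Px sx qx nx (U0 x) (@D_le x y sx).
  rewrite -/(mixture_loss x) -/a -/(l y) -/(e y) => /(ler_wpM2l (pi0 y)).
  have -> : pi y * P x y * D y / n x = pi y * (P x y / n x * D y) by ring.
  move=> /le_trans; apply; rewrite le_eqVlt; apply/orP; left; apply/eqP; ring.
have m1 : measurable_fun setT (fun y => ((a / n x)%:E * (pi y * P x y)%:E)%E).
  by apply/measurable_EFinP; do 2 apply: measurable_funM => //.
have m2 : measurable_fun setT (fun y => (pi y * l y)%:E).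
  by apply/measurable_EFinP; exact: measurable_funM.
have m3 : measurable_fun setT (fun y => (pi y * e y)%:E).
  by apply/measurable_EFinP; exact: measurable_funM.
have m4 : measurable_fun setT (fun y => r%:E * (pi y)%:E)%E.
  by apply/measurable_EFinP; exact: measurable_funM.
have p1 y : (0 <= (a / n x)%:E * (pi y * P x y)%:E)%E.
  by rewrite -EFinM lee_fin !mulr_ge0// invr_ge0.
have p2 y : (0 <= (pi y * l y)%:E)%E by rewrite lee_fin mulr_ge0.
have p3 y : (0 <= (pi y * e y)%:E)%E by rewrite lee_fin mulr_ge0.
have p4 y : (0 <= r%:E * (pi y)%:E)%E by rewrite -EFinM lee_fin mulr_ge0.
rewrite !ge0_integralD//; try (by move=> *; rewrite !adde_ge0);
  try by do ?apply: emeasurable_funD.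
rewrite ge0_integralZl//; last 3 first.
- by apply/measurable_EFinP; exact: measurable_funM.
- by move=> y _; rewrite lee_fin mulr_ge0.
- by rewrite lee_fin divr_ge0.
rewrite ge0_integralZl//; last 2 first.
- exact/measurable_EFinP.
- by move=> y _; rewrite lee_fin.
rewrite intpi mule1 -/(evidence x) -(nE Nx) -EFinM divfK ?gt_eqF//.
have aux (y z : \bar R) : (a%:E + y + z + r%:E = (a + r)%:E + y + z)%E.
  by rewrite addeC !addeA -EFinD (addrC r).
rewrite aux; exact: (leeD2r (H x) (leeD2l (a + r)%:E (G_ge sx Nx))).
Qed.

Let sL x : (0 <= (s x * mixture_loss x)%:E)%E.
Proof. by rewrite lee_fin mulr_ge0// mixture_loss_ge0. Qed.

(* The bound is stated through a measurable majorant because the integrand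
   on its left need not be measurable. *)
Lemma posterior_risk_majorant : exists F : X -> \bar R,
  [/\ measurable_fun setT F, (forall x, (0 <= F x)%E),
      (forall x, 0 < s x -> (evidence x < +oo)%E ->
        ((s x)%:E * (\int[nu]_y (pi y * P x y * D y)%:E * ((fine (evidence x))^-1)%:E)
         <= F x)%E),
      (forall x, 0 < s x -> evidence x = +oo%E -> F x = +oo%E) &
      (\int[mu]_x F x <= (u + g + r + 2)%:E +
         (1 + r)%:E * \int[mu]_x (s x * mixture_loss x)%:E)%E].
Proof.
pose f1 x := (s x * U x)%:E.
pose f2 x := (s x * (q x / s x))%:E.
pose f3 x := ((1 + r)%:E * (s x * mixture_loss x)%:E)%E.
pose f4 x := (r%:E * (s x)%:E)%E.
pose f5 x := ((s x)%:E * G x)%E.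
pose f6 x := ((s x)%:E * H x)%E.
have p1 x : (0 <= f1 x)%E by rewrite lee_fin mulr_ge0.
have p2 x : (0 <= f2 x)%E by rewrite lee_fin mulr_ge0// divr_ge0.
have r1 : 0 <= 1 + r by rewrite addr_ge0.
have p3 x : (0 <= f3 x)%E by rewrite mule_ge0// lee_fin.
have p4 x : (0 <= f4 x)%E by rewrite /f4 -EFinM lee_fin mulr_ge0.
have p5 x : (0 <= f5 x)%E by rewrite mule_ge0// lee_fin.
have p6 x : (0 <= f6 x)%E by rewrite mule_ge0// lee_fin.
have msL : measurable_fun setT (fun x => (s x * mixture_loss x)%:E).
  by apply/measurable_EFinP; apply: measurable_funM => //; exact: measurable_mixture_loss.
have mse : measurable_fun setT (EFin \o s) by exact/measurable_EFinP.
have m1 : measurable_fun setT f1 by apply/measurable_EFinP; exact: measurable_funM.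
have m2 : measurable_fun setT f2.
  apply/measurable_EFinP; apply: measurable_funM => //; exact: measurable_fun_div.
have m3 : measurable_fun setT f3 by apply: emeasurable_funM => //; exact: measurable_cst.
have m4 : measurable_fun setT f4 by apply: emeasurable_funM => //; exact: measurable_cst.
have m5 : measurable_fun setT f5 by exact: emeasurable_funM.
have m6 : measurable_fun setT f6 by exact: emeasurable_funM.
exists (fun x => f1 x + f2 x + f3 x + f4 x + f5 x + f6 x)%E; split.
- by do ?apply: emeasurable_funD.
- by move=> x; rewrite !adde_ge0.
- move=> x sx Nx; apply: le_trans.
    by apply: (lee_wpmul2l _ (posterior_risk_le sx Nx)); rewrite lee_fin.
  have a0 : 0 <= U x + q x / s x + (1 + r) * mixture_loss x + r.
    rewrite addr_ge0// addr_ge0// ?mulr_ge0 ?mixture_loss_ge0//.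
    by rewrite addr_ge0// divr_ge0.
  rewrite ge0_muleDr//; last by rewrite adde_ge0// lee_fin.
  rewrite ge0_muleDr ?lee_fin// -EFinM !mulrDr.
  rewrite /f1 /f2 /f3 /f4 /f5 /f6 -!EFinM -!EFinD [r * _]mulrC.
  by rewrite (mulrCA (1 + r)).
- move=> x sx Nx; rewrite /f5 G_oo// gt0_muley ?lte_fin//.
  rewrite [X in (X + _)%E]addeC -addeA addye//.
  by rewrite gt_eqF// (lt_le_trans ltNy0)// !adde_ge0.
rewrite !ge0_integralD//; try (by move=> *; rewrite !adde_ge0);
  try by do ?apply: emeasurable_funD.
have i2 : (\int[mu]_x f2 x <= 1)%E.
  apply: le_trans intq; apply: ge0_le_integralT => // x; rewrite lee_fin.
  have := s0 x; rewrite le_eqVlt => /orP[/eqP <-|sx]; first by rewrite mul0r.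
  by rewrite mulrC divfK ?gt_eqF.
have i4 : (\int[mu]_x f4 x = r%:E)%E.
  by rewrite ge0_integralZl// ?ints ?mule1// => x _; rewrite lee_fin.
have i6 : (\int[mu]_x f6 x <= 1)%E.
  have -> : (\int[mu]_x f6 x = \int[mu]_x \int[nu]_y
      ((pi y)%:E * (s x * expR (r * ln (P x y / s x) + D y))%:E))%E.
    apply: eq_integral => x _; rewrite /f6 /H -ge0_integralZl ?lee_fin//.
    - by apply: eq_integral => y _; rewrite -!EFinM mulrCA.
    - apply/measurable_EFinP; exact: measurable_funM.
    - by move=> y _; rewrite lee_fin mulr_ge0// expR_ge0.
  rewrite (@integral_swap R _ _ _ _ mu nu (fun x y =>
    ((pi y)%:E * (s x * expR (r * ln (P x y / s x) + D y))%:E)%E)); first last.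
  - by move=> x y; rewrite -EFinM lee_fin !mulr_ge0// expR_ge0.
  - apply/measurable_EFinP; apply: measurable_funM; first exact: measurableT_comp.
    by apply: measurable_funM => //; exact: measurableT_comp.
  rewrite -intpi; apply: ge0_le_integralT => [y|y].
    by apply: integral_ge0 => x _; rewrite -EFinM lee_fin !mulr_ge0// expR_ge0.
  rewrite ge0_integralZl ?lee_fin//.
  - by rewrite -[leRHS]mule1; apply: lee_wpmul2l; rewrite ?lee_fin.
  - apply/measurable_EFinP; exact: measurable_funM.
  - by move=> x _; rewrite lee_fin mulr_ge0// expR_ge0.
have i1 : (\int[mu]_x f1 x <= u%:E)%E by [].
have i5 : (\int[mu]_x f5 x <= g%:E)%E by [].
rewrite i4 [X in (_ + _ + X + _ + _ + _)%E]ge0_integralZl//.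
move: i1 i2 i5 i6; move: (\int[mu]_x f1 x)%E (\int[mu]_x f2 x)%E
  ((1 + r)%:E * _)%E (\int[mu]_x f5 x)%E (\int[mu]_x f6 x)%E.
move=> a1 a2 a3 a5 a6 h1 h2 h5 h6.
(* The two units are the mass of [q] (from [q / s]) and the prior average of the normalised
   exponential moments. *)
apply: (@le_trans _ _ (u%:E + 1 + a3 + r%:E + g%:E + 1)%E); first by rewrite !leeD.
case: a3 => [a3| |] //=.
by rewrite -!EFinD lee_fin; lra.
Qed.
End Risk.

(** * Expected regret of the prior mixture *)

Section MixtureLoss.
Variables (g C M : R) (G : X -> \bar R).
Hypotheses (mG : measurable_fun setT G) (G0 : forall x, (0 <= G x)%E)
  (G_oo : forall x, 0 < s x -> evidence x = +oo%E -> G x = +oo%E)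
  (intG : (\int[mu]_x ((s x)%:E * G x) <= g%:E)%E).

(** Signed expectations are kept as pairs of nonnegative integrals ([klp] and [klm], [lp y] and
    [lm y]), so that inequalities can be integrated before any of them is known to be finite. *)
Let pos_part (f : X -> R) : \bar R := (\int[mu]_x (s x * Num.max (f x) 0)%:E)%E.
Let klp := pos_part (fun x => ln (s x / q x)).
Let klm := pos_part (fun x => - ln (s x / q x)).
Let lp y := pos_part (fun x => ln (P x y / q x)).
Let lm y := pos_part (fun x => - ln (P x y / q x)).
(** Expected posterior density of [y] relative to the prior; by Tonelli its prior average is at most
    one. *)
Let V y := (\int[mu]_x (s x * (P x y / n x))%:E)%E.
Let EL := (\int[mu]_x (s x * mixture_loss x)%:E)%E.

Let pp0 f : (0 <= pos_part f)%E.
Proof. by apply: integral_ge0 => x _; rewrite lee_fin mulr_ge0// le_max lexx orbT. Qed.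

Let EL0 : (0 <= EL)%E.
Proof. by apply: integral_ge0 => x _; rewrite lee_fin mulr_ge0// mixture_loss_ge0. Qed.

Let V0 y : (0 <= V y)%E.
Proof. by apply: integral_ge0 => x _; rewrite lee_fin mulr_ge0// divr_ge0. Qed.

Let mmax (f : X -> R) : measurable_fun setT f ->
  measurable_fun setT (fun x => (s x * Num.max (f x) 0)%:E).
Proof.
move=> mf; apply/measurable_EFinP; apply: measurable_funM => //.
exact: measurable_maxr.
Qed.

Let mPy y : measurable_fun setT (P ^~ y). Proof. exact: measurable_section2. Qed.

(** Since [ln (q / s) <= q / s] and [q] has mass at most one. Finiteness of [klm] keeps [klp - klm]
    from being an undetermined difference. *)
Lemma log_loss_neg_le1 : (klm <= 1)%E.
Proof.
apply: le_trans intq; apply: ge0_le_integralT => x; rewrite lee_fin.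
  by rewrite mulr_ge0// le_max lexx orbT.
have := s0 x; rewrite le_eqVlt => /orP[/eqP <-|sx]; first by rewrite mul0r.
have qx := q_gt0 sx; have := ln_le_subr1 (divr_gt0 qx sx).
rewrite !lnV_lesub// => H.
have m : Num.max (- (ln (s x) - ln (q x))) 0 <= q x / s x.
  by rewrite ge_max divr_ge0// andbT; lra.
apply: le_trans (ler_wpM2l (s0 x) m) _.
by rewrite mulrC divfK ?gt_eqF.
Qed.

(** [tilted_evidence_le] integrated against [s] for one task and a free constant [c], with negative
    parts moved across so that both sides are sums of nonnegative terms. The [1] bounds the total
    evidence, and [g] pays for [G], which is [+oo] at points of infinite evidence. *)
Lemma mixture_loss_tilted y (c : R) :
  (EL + klm + lp y + (Num.max c 0)%:E <=
   1 + klp + lm y + (Num.max (- c) 0)%:E + (expR c)%:E * V y + g%:E)%E.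
Proof.
pose h1 x := (s x * mixture_loss x)%:E.
pose h2 x := (s x * Num.max (- ln (s x / q x)) 0)%:E.
pose h3 x := (s x * Num.max (ln (P x y / q x)) 0)%:E.
pose h4 x := ((Num.max c 0)%:E * (s x)%:E)%E.
pose k2 x := (s x * Num.max (ln (s x / q x)) 0)%:E.
pose k3 x := (s x * Num.max (- ln (P x y / q x)) 0)%:E.
pose k4 x := ((Num.max (- c) 0)%:E * (s x)%:E)%E.
pose k5 x := ((expR c)%:E * (s x * (P x y / n x))%:E)%E.
pose k6 x := ((s x)%:E * G x)%E.
have max0 (a : R) : 0 <= Num.max a 0 by rewrite le_max lexx orbT.
have ph1 x : (0 <= h1 x)%E by rewrite lee_fin mulr_ge0// mixture_loss_ge0.
have ph2 x : (0 <= h2 x)%E by rewrite lee_fin mulr_ge0.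
have ph3 x : (0 <= h3 x)%E by rewrite lee_fin mulr_ge0.
have ph4 x : (0 <= h4 x)%E by rewrite /h4 -EFinM lee_fin mulr_ge0.
have pk2 x : (0 <= k2 x)%E by rewrite lee_fin mulr_ge0.
have pk3 x : (0 <= k3 x)%E by rewrite lee_fin mulr_ge0.
have pk4 x : (0 <= k4 x)%E by rewrite /k4 -EFinM lee_fin mulr_ge0.
have pV x : (0 <= (s x * (P x y / n x))%:E)%E by rewrite lee_fin mulr_ge0// divr_ge0.
have pk5 x : (0 <= k5 x)%E by rewrite mule_ge0// lee_fin expR_ge0.
have pk6 x : (0 <= k6 x)%E by rewrite mule_ge0// lee_fin.
have mse : measurable_fun setT (EFin \o s) by exact/measurable_EFinP.
have msq : measurable_fun setT (fun x => ln (s x / q x)).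
  exact/measurable_fun_ln/measurable_fun_div.
have mPq : measurable_fun setT (fun x => ln (P x y / q x)).
  by apply/measurable_fun_ln/measurable_fun_div => //; exact: mPy.
have mh1 : measurable_fun setT h1.
  by apply/measurable_EFinP; apply: measurable_funM => //; exact: measurable_mixture_loss.
have mh2 : measurable_fun setT h2 by apply: mmax; exact: measurable_funN.
have mh3 : measurable_fun setT h3 by exact: mmax.
have mh4 : measurable_fun setT h4 by apply: emeasurable_funM => //; exact: measurable_cst.
have mk2 : measurable_fun setT k2 by exact: mmax.
have mk3 : measurable_fun setT k3 by apply: mmax; exact: measurable_funN.
have mk4 : measurable_fun setT k4 by apply: emeasurable_funM => //; exact: measurable_cst.
have mV : measurable_fun setT (fun x => (s x * (P x y / n x))%:E).
  by apply/measurable_EFinP; apply: measurable_funM => //; apply: measurable_fun_div.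
have mk5 : measurable_fun setT k5 by apply: emeasurable_funM => //; exact: measurable_cst.
have mk6 : measurable_fun setT k6 by exact: emeasurable_funM.
have := @ge0_le_integralT R _ X mu (fun x => h1 x + h2 x + h3 x + h4 x)%E
  (fun x => evidence x + k2 x + k3 x + k4 x + k5 x + k6 x)%E.
have [mh12 ph12 F12] := ge0_integralTD mu mh1 mh2 ph1 ph2.
have [mh13 ph13 F13] := ge0_integralTD mu mh12 mh3 ph12 ph3.
have [mh14 ph14 F14] := ge0_integralTD mu mh13 mh4 ph13 ph4.
have [mk12 pk12 E12] := ge0_integralTD mu measurable_evidence mk2 evidence_ge0 pk2.
have [mk13 pk13 E13] := ge0_integralTD mu mk12 mk3 pk12 pk3.
have [mk14 pk14 E14] := ge0_integralTD mu mk13 mk4 pk13 pk4.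
have [mk15 pk15 E15] := ge0_integralTD mu mk14 mk5 pk14 pk5.
have [mk16 pk16 E16] := ge0_integralTD mu mk15 mk6 pk15 pk6.
rewrite E16 E15 E14 E13 E12 F14 F13 F12.
rewrite [(\int[mu]_x h4 x)%E]ge0_integralZl//; last 2 first.
- by move=> x _; rewrite lee_fin.
- by rewrite lee_fin.
rewrite [(\int[mu]_x k4 x)%E]ge0_integralZl//; last 2 first.
- by move=> x _; rewrite lee_fin.
- by rewrite lee_fin.
rewrite [(\int[mu]_x k5 x)%E]ge0_integralZl// ?lee_fin ?expR_ge0// ints !mule1.
have i6 : (\int[mu]_x k6 x <= g%:E)%E by [].
move=> H; apply: (le_trans (H _ _)).
- by move=> x; rewrite !adde_ge0.
- move=> x; have := s0 x; rewrite le_eqVlt => /orP[/eqP sx|sx].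
    rewrite /h1 /h2 /h3 /h4 -sx !mul0r mule0 !adde0.
    exact: pk16.
  have := evidence_ge0 x; case E : (evidence x) => [a| |]// a0; last first; first by
    rewrite /k6 G_oo// gt0_muley ?lte_fin// addey ?leey.
  have Nx : (evidence x < +oo)%E by rewrite E ltry.
  have nx := n_gt0 sx Nx; have na : n x = a by rewrite /n E.
  have Px := P_gt0 y sx; have qx := q_gt0 sx.
  apply: le_trans (leeDl _ _); last exact: pk6.
  rewrite /h1 /h2 /h3 /h4 /k2 /k3 /k4 /k5 -!EFinM -!EFinD lee_fin.
  have := @tilted_evidence_le R (s x) (q x) (P x y) (n x) c sx qx Px nx.
  rewrite -/(mixture_loss x) => /(ler_wpM2l (s0 x)).
  have maxB (z : R) : z = Num.max z 0 - Num.max (- z) 0.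
    by have [z0|z0] := leP 0 z; [rewrite max_r|rewrite max_l]; lra.
  have := maxB (ln (s x / q x)); have := maxB (ln (P x y / q x)); have := maxB c.
  move: (Num.max c 0) (Num.max (- c) 0) (Num.max (ln (s x / q x)) 0)
    (Num.max (- ln (s x / q x)) 0) (Num.max (ln (P x y / q x)) 0)
    (Num.max (- ln (P x y / q x)) 0) => c1 c2 a1 a2 b1 b2 cE bE aE.
  rewrite bE aE.
  have -> : s x * (n x / s x + (a1 - a2) - (b1 - b2) - c + P x y / n x * expR c)
     = n x + s x * (a1 - a2) - s x * (b1 - b2) - s x * c + expR c * (s x * (P x y / n x)).
    by field; apply/andP; split; rewrite gt_eqF.
  have -> : s x * c = c1 * s x - c2 * s x by rewrite [X in s x * X]cE; ring.
  rewrite -na; lra.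
have aux (a b c1 d e f : \bar R) : (a <= 1)%E -> (f <= g%:E)%E ->
    (a + b + c1 + d + e + f <= 1 + b + c1 + d + e + g%:E)%E.
  by move=> a1 fg; apply: leeD => //; do 4![apply: leeD2r].
exact: aux integral_evidence_le i6.
Qed.

(** The tilt depends on the task: [c = ln M + (lm y - lp y)] cancels the likelihood terms and leaves
    [EL <= B + M * expR (lm y - lp y) * V y]. Averaging with weights [pi y * w y], of total mass
    [M], turns the last term into [M] times the prior average of [V]; division by [M] gives
    [EL <= B + 1]. *)
Lemma mixture_loss_le :
  (klp < +oo)%E -> (forall y, (lp y <= C%:E)%E) -> 0 < M ->
  (\int[nu]_y ((pi y)%:E * expeR (- (lm y - lp y))) = M%:E)%E ->
  (EL <= (g + 2 - ln M)%:E + (klp - klm))%E.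
Proof.
move=> klp_oo lpC M0 intM.
have /fineK klpE : klp \is a fin_num by rewrite ge0_fin_numE// pp0.
have /fineK klmE : klm \is a fin_num.
  by rewrite ge0_fin_numE ?pp0// (le_lt_trans log_loss_neg_le1)// ltry.
set B := g + 1 - ln M + (fine klp - fine klm).
have B0 : B = Num.max B 0 - Num.max (- B) 0.
  by have [z0|z0] := leP 0 B; [rewrite max_r|rewrite max_l]; lra.
have max0 (a : R) : 0 <= Num.max a 0 by rewrite le_max lexx orbT.
(* The real value of [expeR (- (lm y - lp y))]: since [lp y] is finite, only [lm y = +oo] is
   exceptional, and there the exponential is 0. *)
pose w y := if (lm y < +oo)%E then expR (- (fine (lm y) - fine (lp y))) else 0.
have w0 y : 0 <= w y by rewrite /w; case: ifP => // _; exact: expR_ge0.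
have lpE y : (fine (lp y))%:E = lp y.
  by rewrite fineK// ge0_fin_numE ?pp0// (le_lt_trans (lpC y))// ltry.
have wE y : expeR (- (lm y - lp y)) = (w y)%:E.
  rewrite /w; case: ifPn => [lmy|].
    have /fineK <- : lm y \is a fin_num by rewrite ge0_fin_numE ?pp0.
    by rewrite -lpE.
  by rewrite -leNgt leye_eq => /eqP ->; rewrite -lpE.
have key y : ((w y)%:E * (EL + (Num.max (- B) 0)%:E) <=
    (w y)%:E * (Num.max B 0)%:E + M%:E * V y)%E.
  rewrite /w; case: ifPn => [lmy|_]; last first.
    by rewrite !mul0e add0e mule_ge0// lee_fin ltW.
  have /fineK lmE : lm y \is a fin_num by rewrite ge0_fin_numE ?pp0.
  set e := fine (lm y) - fine (lp y).
  have := mixture_loss_tilted y (ln M + e).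
  rewrite -klpE -klmE -lmE -lpE expRD lnK ?posrE//.
  have maxc : ln M + e = Num.max (ln M + e) 0 - Num.max (- (ln M + e)) 0.
    by have [z0|z0] := leP 0 (ln M + e); [rewrite max_r|rewrite max_l]; lra.
  move: maxc; move: (Num.max (ln M + e) 0) (Num.max (- (ln M + e)) 0) => c1 c2 cE.
  have := V0 y; case: (V y) => [v| |]// v0; last first.
    by move=> _; rewrite gt0_muley ?lte_fin// addey// leey.
  have := EL0; case: EL => [el| |]// el0.
  rewrite -!EFinM -!EFinD !lee_fin => H.
  have ee : expR (- e) * expR e = 1 by rewrite -expRD addNr expR0.
  have H2 : el + Num.max (- B) 0 <= Num.max B 0 + M * expR e * v.
    move: B0; rewrite {1}/B; move: H cE; rewrite /e; lra.
  have := ler_wpM2l (expR_ge0 (- e)) H2; rewrite [X in _ <= X -> _]mulrDr.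
  have -> : expR (- e) * (M * expR e * v) = M * v.
    by rewrite (mulrC M) -!mulrA mulrA ee mul1r.
  by [].
have mlp : measurable_fun setT lp.
  apply: (@measurable_integral1 R _ _ _ _ mu (fun x y => (s x * Num.max (ln (P x y / q x)) 0)%:E)).
    apply/measurable_EFinP; apply: measurable_funM; first exact: measurableT_comp.
    apply: measurable_maxr => //; apply: measurable_fun_ln; apply: measurable_fun_div => //.
    exact: measurableT_comp.
  by move=> x y; rewrite lee_fin mulr_ge0.
have mlm : measurable_fun setT lm.
  apply: (@measurable_integral1 R _ _ _ _ mu (fun x y => (s x * Num.max (- ln (P x y / q x)) 0)%:E)).
    apply/measurable_EFinP; apply: measurable_funM; first exact: measurableT_comp.
    apply: measurable_maxr => //; apply: measurable_funN.
    apply: measurable_fun_ln; apply: measurable_fun_div => //.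
    exact: measurableT_comp.
  by move=> x y; rewrite lee_fin mulr_ge0.
have mw : measurable_fun setT w.
  apply: measurable_fun_ifT => //; first by apply: measurable_fun_lte => //; exact: measurable_cst.
  apply: measurable_fun_expR; apply: measurable_funN.
  by apply: measurable_funB; apply: measurableT_comp.
have mVf : measurable_fun setT (fun z : X * Y => (s z.1 * (P z.1 z.2 / n z.1))%:E).
  apply/measurable_EFinP; apply: measurable_funM; first exact: measurableT_comp.
  by apply: measurable_fun_div => //; exact: measurableT_comp.
have pVf x y : (0 <= (s x * (P x y / n x))%:E)%E by rewrite lee_fin mulr_ge0// divr_ge0.
have mV : measurable_fun setT V by exact: (@measurable_integral1 R _ _ _ _ mu (fun x y => _)).
have mpie : measurable_fun setT (EFin \o pi) by exact/measurable_EFinP.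
have mpw : measurable_fun setT (fun y => (pi y * w y)%:E).
  by apply/measurable_EFinP; exact: measurable_funM.
have ppw y : (0 <= (pi y * w y)%:E)%E by rewrite lee_fin mulr_ge0.
have intw : (\int[nu]_y (pi y * w y)%:E = M%:E)%E.
  by rewrite -intM; apply: eq_integral => y _; rewrite wE.
have intV : (\int[nu]_y ((pi y)%:E * V y) <= 1)%E.
  have -> : (\int[nu]_y ((pi y)%:E * V y) =
      \int[nu]_y \int[mu]_x ((s x / n x)%:E * (pi y * P x y)%:E))%E.
    apply: eq_integral => y _; rewrite /V -ge0_integralZl ?lee_fin//; last first.
      exact: (@measurable_section2 _ _ _ _ _ _ (fun x y => (s x * (P x y / n x))%:E)).
    by apply: eq_integral => x _; rewrite -!EFinM; congr EFin; ring.
  rewrite -(@integral_swap R _ _ _ _ mu nu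
    (fun x y => (s x / n x)%:E * (pi y * P x y)%:E)%E); first last.
  - by move=> x y; rewrite -EFinM lee_fin !mulr_ge0// invr_ge0.
  - apply/measurable_EFinP; apply: measurable_funM => //.
    by apply: measurable_fun_div; exact: measurableT_comp.
  rewrite -ints; apply: ge0_le_integralT => x.
    by apply: integral_ge0 => y _; rewrite -EFinM lee_fin !mulr_ge0// invr_ge0.
  rewrite ge0_integralZl ?lee_fin ?divr_ge0//; last 2 first.
  - by apply/measurable_EFinP; exact: measurable_funM.
  - by move=> y _; rewrite lee_fin mulr_ge0.
  rewrite -/(evidence x); have := s0 x; rewrite le_eqVlt => /orP[/eqP <-|sx].
    by rewrite mul0r mul0e.
  have [Nx|] := ltP (evidence x) +oo%E.
    by rewrite -(nE Nx) -EFinM divfK ?gt_eqF// n_gt0.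
  rewrite leye_eq => /eqP Nx; rewrite /n Nx /= invr0 mulr0 mul0e lee_fin.
  exact: s0.
have : (\int[nu]_y ((pi y * w y)%:E * (EL + (Num.max (- B) 0)%:E)) <=
    \int[nu]_y ((pi y * w y)%:E * (Num.max B 0)%:E + M%:E * ((pi y)%:E * V y)))%E.
  apply: ge0_le_integralT => y; first by rewrite mule_ge0// adde_ge0// lee_fin.
  rewrite !EFinM -!muleA; have := key y => /(lee_wpmul2l (_ : 0 <= (pi y)%:E)%E).
  rewrite lee_fin => /(_ (pi0 y)) /le_trans; apply.
  have a1 : (0 <= (w y)%:E * (Num.max B 0)%:E)%E by rewrite mule_ge0// lee_fin.
  have a2 : (0 <= M%:E * V y)%E by rewrite mule_ge0// lee_fin ltW.
  by rewrite ge0_muleDr// (muleCA (pi y)%:E M%:E).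
rewrite ge0_integralZr//; last by rewrite adde_ge0// lee_fin.
have m1 : measurable_fun setT (fun y => (pi y * w y)%:E * (Num.max B 0)%:E)%E.
  by apply: emeasurable_funM => //; exact: measurable_cst.
have mpV : measurable_fun setT (fun y => (pi y)%:E * V y)%E by exact: emeasurable_funM.
have ppV y : (0 <= (pi y)%:E * V y)%E by rewrite mule_ge0// lee_fin.
have m2 : measurable_fun setT (fun y => M%:E * ((pi y)%:E * V y))%E.
  by apply: emeasurable_funM => //; exact: measurable_cst.
have p1 y : (0 <= (pi y * w y)%:E * (Num.max B 0)%:E)%E by rewrite mule_ge0 ?lee_fin ?mulr_ge0.
have p2 y : (0 <= M%:E * ((pi y)%:E * V y))%E by rewrite mule_ge0// lee_fin ltW.
have [_ _ ->] := ge0_integralTD nu m1 m2 p1 p2.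
rewrite ge0_integralZr ?lee_fin// ge0_integralZl ?lee_fin ?(ltW M0)//. rewrite intw => H.
have {H} : (M%:E * (EL + (Num.max (- B) 0)%:E) <= M%:E * (Num.max B 0)%:E + M%:E * 1)%E.
  apply: (le_trans H); apply: leeD => //; apply: lee_wpmul2l => //.
  by rewrite lee_fin ltW.
have := EL0; rewrite -klpE -klmE; case: EL => [el| |]// el0; last first.
  by rewrite addye// gt0_muley ?lte_fin// -!EFinM -!EFinD leye_eq.
rewrite mule1 -EFinB -!EFinM -!EFinD !lee_fin => H.
have {H} : M * (el + Num.max (- B) 0) <= M * (Num.max B 0 + 1) by move: H; lra.
rewrite ler_pM2l//.
by rewrite -/B => H; move: B0; rewrite {1}/B; lra.
Qed.

End MixtureLoss.
End Posterior.

(** * Hellinger affinities and finite covers *)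

Section Affinity.
Set Implicit Arguments.
Unset Strict Implicit.
Context {R : realType} dX (X : measurableType dX).
Variables (mu : {measure set X -> \bar R}) (s : X -> R) (r : R).
Hypotheses (ms : measurable_fun setT s) (s0 : forall x, 0 <= s x)
  (ints : (\int[mu]_x (s x)%:E = 1)%E) (r01 : 0 < r < 1).

(* [int s^(1-r) p^r] restricted to [B], for densities [p] positive where [s] is *)
Definition affinity (B : X -> bool) (p : X -> R) : \bar R :=
  (\int[mu]_x (s x * (if B x then expR (r * ln (p x / s x)) else 0))%:E)%E.

Definition admissible (p : X -> R) := [/\ measurable_fun setT p, forall x, 0 <= p x,
  (forall x, 0 < s x -> 0 < p x) & (\int[mu]_x (p x)%:E <= 1)%E].

Let mexp (p : X -> R) : measurable_fun setT p ->
  measurable_fun setT (fun x => expR (r * ln (p x / s x))).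
Proof.
move=> mp; apply: measurable_fun_expR; apply: measurable_funM => //.
exact/measurable_fun_ln/measurable_fun_div.
Qed.

Lemma measurable_affinity_integrand (B : X -> bool) (p : X -> R) : measurable_fun setT B ->
  measurable_fun setT p -> measurable_fun setT
    (fun x => s x * (if B x then expR (r * ln (p x / s x)) else 0)).
Proof.
move=> mB mp; apply: measurable_funM => //; apply: measurable_fun_ifT => //.
exact: mexp.
Qed.

Let intg0 (B : X -> bool) p x : (0 <= (s x * (if B x then expR (r * ln (p x / s x)) else 0))%:E)%E.
Proof. by rewrite lee_fin mulr_ge0//; case: ifP => // _; exact: expR_ge0. Qed.

Lemma affinity_le1 B p : admissible p -> (affinity B p <= 1)%E.
Proof.
move=> [mp p0 sp intp]; have /andP[r0 r1] := r01.
apply: (@le_trans _ _ (\int[mu]_x ((1 - r)%:E * (s x)%:E + r%:E * (p x)%:E))%E).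
  apply: ge0_le_integralT => x; first exact: intg0.
  rewrite -!EFinM -!EFinD lee_fin.
  have := s0 x; rewrite le_eqVlt => /orP[/eqP <-|sx].
    by rewrite mul0r mulr0 add0r mulr_ge0// ltW.
  have px := sp _ sx; have ps := divr_gt0 px sx.
  apply: (@le_trans _ _ (s x * (1 - r + r * (p x / s x)))).
    apply: ler_wpM2l => //; case: ifP => _.
      have -> : expR (r * ln (p x / s x)) = (p x / s x) `^ r by rewrite /powR gt_eqF.
      by apply: powR_le_affine => //; exact: ltW.
    have : 0 <= r * (p x / s x) by rewrite mulr_ge0// ltW.
    lra.
  by rewrite le_eqVlt; apply/orP; left; apply/eqP; field; rewrite gt_eqF.
have mse : measurable_fun setT (EFin \o s) by exact/measurable_EFinP.
have mpe : measurable_fun setT (EFin \o p) by exact/measurable_EFinP.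
have m1 : measurable_fun setT (fun x => (1 - r)%:E * (s x)%:E)%E.
  by apply: emeasurable_funM => //; exact: measurable_cst.
have m2 : measurable_fun setT (fun x => r%:E * (p x)%:E)%E.
  by apply: emeasurable_funM => //; exact: measurable_cst.
have p1 x : (0 <= (1 - r)%:E * (s x)%:E)%E by rewrite -EFinM lee_fin mulr_ge0//; lra.
have p2 x : (0 <= r%:E * (p x)%:E)%E by rewrite -EFinM lee_fin mulr_ge0// ltW.
have [_ _ ->] := ge0_integralTD mu m1 m2 p1 p2.
rewrite ge0_integralZl//; first rewrite ge0_integralZl//.
- rewrite ints mule1 (_ : 1%E = (1 - r)%:E + r%:E)%E; last by rewrite -EFinD subrK.
  by apply: leeD => //; rewrite -[leRHS]mule1; apply: lee_wpmul2l => //; rewrite lee_fin ltW.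
- by move=> x _; rewrite lee_fin.
- by rewrite lee_fin ltW.
- by move=> x _; rewrite lee_fin.
- by rewrite lee_fin; lra.
Qed.

Lemma affinity_gt0 (B : X -> bool) p : measurable_fun setT B -> admissible p ->
  (0 < \int[mu]_x (s x * (B x)%:R)%:E)%E -> (0 < affinity B p)%E.
Proof.
move=> mB [mp p0 sp intp].
apply: integral_gt0_support.
- apply: measurable_funM => //.
  rewrite (_ : (fun x => _) = fun x => if B x then 1 else 0).
    by apply: measurable_fun_ifT => //; exact: measurable_cst.
  by apply/funext => x; case: (B x).
- exact: measurable_affinity_integrand.
- by move=> x; rewrite mulr_ge0.
- by move=> x; rewrite mulr_ge0//; case: ifP => // _; exact: expR_ge0.
- move=> x; case: (B x); last by rewrite mulr0 ltxx.
  by rewrite mulr1 => sx; rewrite mulr_gt0// expR_gt0.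
Qed.

Section Cover.
Variables (I : finType) (Q : I -> X -> R) (B : X -> bool).
Hypotheses (mB : measurable_fun setT B) (admQ : forall i, admissible (Q i))
  (intB : (0 < \int[mu]_x (s x * (B x)%:R)%:E)%E).

Let a i := fine (affinity B (Q i)).
Let J : R := #|I|%:R.
Let e i x := if B x then expR (r * ln (Q i x / s x)) else 0.
Let S x := \sum_(i : I) e i x / a i.

(** Each [e i / a i] has mean one under [s], so [S] has mean [J]. The formula is a slightly enlarged
    tangent bound of [1 + ln (1 + S x)] at [S x = J]; being affine in [S] it integrates at once. The
    leading 1 pays for the discretisation error. *)
Definition cover_loss x := 1 + ln (1 + J) + S x / (1 + J).

Let aE i : (a i)%:E = affinity B (Q i).
Proof.
rewrite fineK// ge0_fin_numE; last exact/ltW/affinity_gt0.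
by apply: le_lt_trans (affinity_le1 _ (admQ i)) _; rewrite ltry.
Qed.

Let a_gt0 i : 0 < a i. Proof. by rewrite -lte_fin aE affinity_gt0. Qed.

Let e0 i x : 0 <= e i x. Proof. by rewrite /e; case: ifP => // _; exact: expR_ge0. Qed.

Let S0 x : 0 <= S x. Proof. by apply: sumr_ge0 => i _; rewrite divr_ge0// ltW. Qed.

Let J0 : 0 <= J. Proof. exact: ler0n. Qed.

Let me i : measurable_fun setT (e i).
Proof. by apply: measurable_fun_ifT => //; apply: mexp; case: (admQ i). Qed.

Lemma measurable_cover_loss : measurable_fun setT cover_loss.
Proof.
apply: measurable_funD => //; apply: measurable_funM => //.
apply: measurable_sum => i; apply: measurable_funM => //.
Qed.

Lemma cover_loss_ge0 x : 0 <= cover_loss x.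
Proof.
have J1 : 1 <= 1 + J by rewrite lerDl.
rewrite addr_ge0// ?divr_ge0// ?(le_trans ler01 J1)//.
by rewrite addr_ge0// ln_ge0.
Qed.

Lemma integral_cover_loss :
  (\int[mu]_x (s x * cover_loss x)%:E <= (2 + ln (1 + J))%:E)%E.
Proof.
have lnJ : 0 <= ln (1 + J) by rewrite ln_ge0// lerDl.
pose c := 1 + ln (1 + J).
have mse : measurable_fun setT (EFin \o s) by exact/measurable_EFinP.
have mt i : measurable_fun setT (fun x => (1 + J)^-1%:E * ((a i)^-1%:E * (s x * e i x)%:E))%E.
  apply/measurable_EFinP; do 2 apply: measurable_funM => //.
  exact: measurable_funM.
have pt i x : (0 <= (1 + J)^-1%:E * ((a i)^-1%:E * (s x * e i x)%:E))%E.
  by rewrite -!EFinM lee_fin !mulr_ge0// invr_ge0 ?addr_ge0// ltW.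
have E x : ((s x * cover_loss x)%:E = c%:E * (s x)%:E +
    \sum_(i : I) (1 + J)^-1%:E * ((a i)^-1%:E * (s x * e i x)%:E))%E.
  rewrite -EFinM; under eq_bigr do rewrite -!EFinM.
  rewrite sumEFin -EFinD; congr EFin.
  rewrite /cover_loss -/c mulrDr (mulrC (s x) c); congr (_ + _).
  by rewrite /S mulr_suml mulr_sumr; apply: eq_bigr => i _; ring.
under eq_integral do rewrite E.
have m1 : measurable_fun setT (fun x => c%:E * (s x)%:E)%E.
  by apply: emeasurable_funM => //; exact: measurable_cst.
have p1 x : (0 <= c%:E * (s x)%:E)%E by rewrite -EFinM lee_fin mulr_ge0// /c addr_ge0.
have m2 : measurable_fun setT (fun x => \sum_(i : I)
    (1 + J)^-1%:E * ((a i)^-1%:E * (s x * e i x)%:E))%E.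
  exact: emeasurable_sum.
have p2 x : (0 <= \sum_(i : I) (1 + J)^-1%:E * ((a i)^-1%:E * (s x * e i x)%:E))%E.
  exact: sume_ge0.
have [_ _ ->] := ge0_integralTD mu m1 m2 p1 p2.
rewrite ge0_integralZl//; last 2 first.
- by move=> x _; rewrite lee_fin.
- by rewrite lee_fin /c addr_ge0.
rewrite ints mule1 ge0_integral_sum//.
have EI i : (\int[mu]_x ((1 + J)^-1%:E * ((a i)^-1%:E * (s x * e i x)%:E)) = ((1 + J)^-1)%:E)%E.
  have mi : measurable_fun setT (fun x => (s x * e i x)%:E).
    by apply/measurable_EFinP; exact: measurable_funM.
  have pi' x : (0 <= (s x * e i x)%:E)%E by rewrite lee_fin mulr_ge0.
  rewrite ge0_integralZl//; last 3 first.
  - by apply: emeasurable_funM => //; exact: measurable_cst.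
  - by move=> x _; rewrite mule_ge0// lee_fin invr_ge0 ltW.
  - by rewrite lee_fin invr_ge0 addr_ge0.
  rewrite ge0_integralZl//; last by rewrite lee_fin invr_ge0 ltW.
  rewrite -/(affinity B (Q i)) -aE -!EFinM mulVf ?mulr1// gt_eqF//; exact: a_gt0.
under eq_bigr do rewrite EI.
rewrite sumEFin -EFinD lee_fin sumr_const -mulr_natl -/J /c.
have : J * (1 + J)^-1 <= 1 by rewrite ler_pdivrMr ?mul1r ?lerDr// ltr_pwDl.
lra.
Qed.

(** Closeness on [B] is used twice, at a cost of [r / 2] each time. The full affinity of [p] is at
    least [expR (- (r / 2))] times that of [Q i] over [B], which is why the [a i] are restricted to
    [B]; and [r * ln (p x)] is traded for [r * ln (Q i x)]. The remaining normalised ratio of [Q i]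
    is one summand of [S x]. *)
Lemma cover_loss_dominates p i d : admissible p ->
  (forall x, B x -> 0 < s x -> `|ln (p x / Q i x)| <= 2^-1) ->
  (affinity xpredT p = (expR (- d))%:E) ->
  forall x, B x -> 0 < s x -> d <= cover_loss x + r * ln (s x / p x).
Proof.
move=> admp pQ affp x Bx sx; have /andP[r0 r1] := r01.
have [mp p0 sp intp] := admp; have [mQ Q0 sQ intQ] := admQ i.
have le_ln z : B z -> 0 < s z -> ln (Q i z) - 2^-1 <= ln (p z) <= ln (Q i z) + 2^-1.
  move=> Bz sz; have := pQ z Bz sz; rewrite lnV_lesub ?sp ?sQ// ler_norml.
  by move=> /andP[? ?]; apply/andP; split; lra.
have d_le : d <= r / 2 - ln (a i).
  suff : expR (- (r / 2)) * a i <= expR (- d).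
    rewrite -ler_ln ?posrE ?mulr_gt0 ?expR_gt0// lnM ?posrE ?expR_gt0// !expRK.
    lra.
  rewrite -lee_fin EFinM aE -affp /affinity -ge0_integralZl//.
  - apply: ge0_le_integralT => z.
      by rewrite mule_ge0// lee_fin expR_ge0.
    rewrite -EFinM lee_fin mulrCA; have := s0 z; rewrite le_eqVlt => /orP[/eqP <-|sz].
      by rewrite !mul0r.
    apply: ler_wpM2l => //; case: ifP => [Bz|_]; last by rewrite mulr0 expR_ge0.
    rewrite -expRD ler_expR !lnV_lesub ?sp ?sQ//.
    have /andP[h1 h2] := le_ln z Bz sz.
    have : r * (ln (Q i z) - 2^-1) <= r * ln (p z) by apply: ler_wpM2l => //; exact: ltW.
    lra.
  - by apply/measurable_EFinP; exact: measurable_affinity_integrand.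
have S_ge : ln (e i x / a i) <= ln (1 + S x).
  have ea : 0 < e i x / a i by rewrite divr_gt0// /e Bx expR_gt0.
  have : e i x / a i <= S x.
    rewrite /S (bigD1 i)//= lerDl; apply: sumr_ge0 => j _.
    by rewrite divr_ge0// ltW.
  move=> h; rewrite ler_ln ?posrE//; first lra.
  by have := S0 x; lra.
have SJ : ln (1 + S x) <= ln (1 + J) + S x / (1 + J).
  have J1 : 0 < 1 + J by rewrite ltr_pwDl.
  have S1 : 0 < 1 + S x by have := S0 x; lra.
  have := ln_le_subr1 (divr_gt0 S1 J1); rewrite lnV_lesub//.
  have : (1 + S x) / (1 + J) - 1 <= S x / (1 + J).
    rewrite mulrDl mul1r; have : (1 + J)^-1 <= 1 by rewrite invf_le1// lerDl.
    lra.
  lra.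
move: S_ge; rewrite /e Bx lnV_lesub ?expR_gt0// expRK !lnV_lesub ?sp ?sQ// => S_ge.
have /andP[h1 h2] := le_ln x Bx sx.
have : r * ln (p x) <= r * (ln (Q i x) + 2^-1) by apply: ler_wpM2l => //; exact: ltW.
rewrite /cover_loss; lra.
Qed.

End Cover.
End Affinity.

(** * Tail events *)

Section Tail.
Set Implicit Arguments.
Unset Strict Implicit.
Context {R : realType} dX dY (X : measurableType dX) (Y : measurableType dY).
Variables (mu : {sigma_finite_measure set X -> \bar R}).
Variables (nu : {sigma_finite_measure set Y -> \bar R}).
Variables (P : X -> Y -> R) (s q : X -> R) (pi : Y -> R).
Hypotheses (mP : measurable_fun setT (fun z : X * Y => P z.1 z.2))
  (ms : measurable_fun setT s) (mq : measurable_fun setT q)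
  (mpi : measurable_fun setT pi).
Hypotheses (P0 : forall x y, 0 <= P x y) (s0 : forall x, 0 <= s x)
  (q0 : forall x, 0 <= q x) (pi0 : forall y, 0 <= pi y).
Hypotheses (P_gt0 : forall x y, 0 < s x -> 0 < P x y)
  (q_gt0 : forall x, 0 < s x -> 0 < q x).
Hypotheses (intpi : (\int[nu]_y (pi y)%:E = 1)%E).

Variables (I : (X -> \bar R) -> \bar R).
Hypotheses (mI : monotone_functional I) (rI : represents I mu).
Variables (f : Y -> bool) (B : X -> bool) (S : X -> \bar R) (E1 E2 : set X).
Variables (c e lam : R).
Hypotheses (mf : measurable_fun setT f) (mB : measurable_fun setT B)
  (S0 : forall x, 0 < s x -> (0 <= S x)%E)
  (S_ge : forall x y, 0 < s x -> ((ln (P x y / q x))%:E <= S x)%E)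
  (E1P : forall x y, 0 < s x -> B x -> f y -> q x < P x y -> E1 x)
  (E2P : forall x, 0 < s x -> ~~ B x -> E2 x)
  (IS : (I (fun x => (s x)%:E * (S x * S x)) <= c%:E)%E)
  (IE1 : (I (fun x => (s x)%:E * (\1_E1 x)%:E) <= e%:E)%E)
  (IE2 : (I (fun x => (s x)%:E * (\1_E2 x)%:E) <= e%:E)%E)
  (lam0 : 0 < lam).

Let N := evidence nu P pi.
Let n x := fine (N x).
Let l x y := if f y || ~~ B x then P x y / n x * Num.max (ln (P x y / q x)) 0 else 0.
Let W x : \bar R := (\int[nu]_y (pi y * l x y)%:E)%E.
(** The value [+oo] follows the convention of [postE], so that the final majorant is infinite
    wherever the posterior is undefined for that reason. *)
Let G x : \bar R := if (N x < +oo)%E then W x else +oo%E.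

Let N0 x : (0 <= N x)%E. Proof. exact: evidence_ge0. Qed.

Let mN : measurable_fun setT N. Proof. exact: measurable_evidence. Qed.

Let n0 x : 0 <= n x. Proof. by rewrite fine_ge0. Qed.

Let mPx x : measurable_fun setT (P x). Proof. exact: measurable_section1. Qed.

Let l0 x y : 0 <= l x y.
Proof.
rewrite /l; case: ifP => // _.
by rewrite mulr_ge0 ?divr_ge0// le_max lexx orbT.
Qed.

Let ml : measurable_fun setT (fun z : X * Y => (pi z.2 * l z.1 z.2)%:E).
Proof.
apply/measurable_EFinP; apply: measurable_funM; first exact: measurableT_comp.
have mn : measurable_fun setT n by exact: measurableT_comp.
apply: measurable_fun_ifT => //.
  apply: measurable_or; first exact: measurableT_comp.
  by apply: measurable_neg; exact: measurableT_comp.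
apply: measurable_funM.
  by apply: measurable_fun_div => //; exact: measurableT_comp.
apply: measurable_maxr => //; apply: measurable_fun_ln.
by apply: measurable_fun_div => //; exact: measurableT_comp.
Qed.

Let pil0 x y : (0 <= (pi y * l x y)%:E)%E. Proof. by rewrite lee_fin mulr_ge0. Qed.

Let W0 x : (0 <= W x)%E. Proof. by apply: integral_ge0 => y _; exact: pil0. Qed.

Let G0 x : (0 <= G x)%E. Proof. by rewrite /G; case: ifP => // _; exact: leey. Qed.

Let mW : measurable_fun setT W.
Proof. exact: (@measurable_integral2 R _ _ _ _ nu (fun x y => (pi y * l x y)%:E)). Qed.

Let mG : measurable_fun setT G.
Proof.
by apply: measurable_fun_ifT => //; apply: measurable_fun_lte.
Qed.

(** A finite supremum bounds every [P x y] by [q x * expR sg], and the prior has mass one. Hence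
    infinite evidence forces [S x = +oo], and [G <= S] survives there. *)
Let evidence_finite x (sg : R) : 0 < s x -> S x = sg%:E -> (N x < +oo)%E.
Proof.
move=> sx Sx; have qx := q_gt0 sx.
apply: (@le_lt_trans _ _ (q x * expR sg)%:E); last exact: ltry.
apply: (@le_trans _ _ (\int[nu]_y ((q x * expR sg)%:E * (pi y)%:E))%E).
  apply: ge0_le_integralT => y; first by rewrite lee_fin mulr_ge0.
  rewrite -EFinM lee_fin mulrC; apply: ler_wpM2r => //.
  have := S_ge y sx; rewrite Sx lee_fin -ler_expR lnK; last first.
    by rewrite posrE divr_gt0// P_gt0.
  by rewrite ler_pdivrMr// mulrC.
rewrite ge0_integralZl//; first by rewrite intpi mule1.
- exact/measurable_EFinP.
- by move=> y _; rewrite lee_fin.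
- by rewrite lee_fin mulr_ge0// expR_ge0.
Qed.

Let W_le_S x : 0 < s x -> (N x < +oo)%E -> (W x <= S x)%E.
Proof.
move=> sx Nx; have := S0 sx; case Sx : (S x) => [sg| |]// sg0; last exact: leey.
have NE : (n x)%:E = N x by rewrite fineK// ge0_fin_numE.
have nx : 0 < n x.
  by rewrite -lte_fin NE; apply: evidence_gt0 sx => //; rewrite intpi.
have sg0' : 0 <= sg by rewrite -lee_fin.
apply: (@le_trans _ _ (\int[nu]_y ((sg / n x)%:E * (pi y * P x y)%:E))%E).
  apply: ge0_le_integralT => y; first exact: pil0.
  rewrite -EFinM lee_fin.
  have -> : sg / n x * (pi y * P x y) = pi y * (P x y / n x * sg) by ring.
  apply: ler_wpM2l => //; have Pn0 : 0 <= P x y / n x by rewrite divr_ge0.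
  rewrite /l; case: ifP => _; last by rewrite mulr_ge0.
  apply: ler_wpM2l => //; rewrite ge_max sg0' andbT.
  by have := S_ge y sx; rewrite Sx lee_fin.
rewrite ge0_integralZl//; last 3 first.
- by apply/measurable_EFinP; exact: measurable_funM.
- by move=> y _; rewrite lee_fin mulr_ge0.
- by rewrite lee_fin divr_ge0.
by rewrite -[(\int[nu]_y _)%E]/(N x) -NE -EFinM divfK// gt_eqF.
Qed.

Let G_le_S x : 0 < s x -> (G x <= S x)%E.
Proof.
move=> sx; rewrite /G; case: ifPn => [Nx|]; first exact: W_le_S.
have := S0 sx; case Sx : (S x) => [sg| |]// sg0.
by rewrite (evidence_finite sx Sx).
Qed.

(** On bounded data only far tasks enter [W], and each of them contributes 0 unless it beats the
    reference task; a positive [W x] therefore exhibits the first tail event. *)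
Let W_gt0 x : 0 < s x -> B x -> (0 < W x)%E -> E1 x.
Proof.
move=> sx Bx; apply: contraPP => nE; apply/negP; rewrite -leNgt.
rewrite /W integral0_eq// => y _; rewrite /l Bx orbF.
case: ifPn => fy; last by rewrite mulr0.
have Pq : P x y <= q x by rewrite leNgt; apply/negP => /(E1P sx Bx fy).
rewrite max_r ?mulr0//; have qx := q_gt0 sx; have Px := P_gt0 y sx.
rewrite lnV_lesub// subr_le0 ler_ln//.
Qed.

(** Points with [G x = +oo] are left out: the quadratic term of [G_le] covers them, and at infinite
    evidence [G x > 0] says nothing about [W x]. *)
Let V1 x : \bar R := (((0 < G x)%E && (G x < +oo)%E && B x)%:R)%:E.
Let V2 x : \bar R := (((~~ B x))%:R)%:E.

Let mbool (b : X -> bool) : measurable_fun setT b ->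
  measurable_fun setT (fun x => ((b x)%:R : R)%:E).
Proof.
move=> mb; rewrite (_ : (fun x => _) = fun x => (if b x then 1 else 0 : R)%:E).
  by apply/measurable_EFinP; apply: measurable_fun_ifT => //; exact: measurable_cst.
by apply/funext => x; case: (b x).
Qed.

(* AM-GM: [G <= lam G^2 + 1 / lam], where the second term is only needed on [G > 0] *)
Let G_le x : (G x <= lam%:E * (G x * G x) + lam^-1%:E * V1 x + lam^-1%:E * V2 x)%E.
Proof.
rewrite /V1 /V2; have lV : 0 < lam^-1 by rewrite invr_gt0.
have := G0 x; case: (G x) => [g| |]// g0; last first.
  by rewrite mulyy gt0_muley ?lte_fin// ltxx andbF/= -!EFinM !addye.
rewrite ltry andbT -!EFinM -!EFinD lee_fin lte_fin.
move: g0; rewrite lee_fin le_eqVlt => /orP[/eqP <-|g0].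
  by rewrite ltxx/= !mulr0 !add0r mulr_ge0// ltW.
have H : g <= lam * (g * g) + lam^-1.
  rewrite -(ler_pM2l lam0) mulrDr divff ?gt_eqF//.
  have := sqr_ge0 (lam * g - 2^-1); rewrite expr2; nra.
rewrite g0/=; case: (B x); rewrite /= ?mulr1 ?mulr0; lra.
Qed.

(** [S] is a supremum over tasks, so its moment is known only under [I]. The measurable [G] lies
    below it: monotonicity of [I] compares the two, and [rI] then turns the smaller side into an
    integral. *)
Let IG2 : (\int[mu]_x ((s x)%:E * (G x * G x)) <= c%:E)%E.
Proof.
apply: le_trans IS; rewrite -rI.
- apply: mI => x; first by rewrite !mule_ge0// lee_fin.
  have := s0 x; rewrite le_eqVlt => /orP[/eqP <-|sx]; first by rewrite !mul0e.
  apply: lee_wpmul2l; first by rewrite lee_fin.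
  by apply: lee_pmul => //; exact: G_le_S.
- apply: emeasurable_funM; first exact/measurable_EFinP.
  exact: emeasurable_funM.
- by move=> x; rewrite !mule_ge0// lee_fin.
Qed.

Let mse : measurable_fun setT (EFin \o s). Proof. exact/measurable_EFinP. Qed.

Let mV1 : measurable_fun setT V1.
Proof.
apply: mbool; apply: measurable_and => //; apply: measurable_and.
  by apply: measurable_fun_lte => //; exact: measurable_cst.
by apply: measurable_fun_lte => //; exact: measurable_cst.
Qed.

Let mV2 : measurable_fun setT V2.
Proof. by apply: mbool; exact: measurable_neg. Qed.

Let V10 x : (0 <= V1 x)%E. Proof. by rewrite lee_fin ler0n. Qed.
Let V20 x : (0 <= V2 x)%E. Proof. by rewrite lee_fin ler0n. Qed.

Let IV1 : (\int[mu]_x ((s x)%:E * V1 x) <= e%:E)%E.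
Proof.
apply: le_trans IE1; rewrite -rI.
- apply: mI => x; first by rewrite mule_ge0// lee_fin.
  have := s0 x; rewrite le_eqVlt => /orP[/eqP <-|sx]; first by rewrite !mul0e.
  apply: lee_wpmul2l; first by rewrite lee_fin.
  rewrite /V1; case: (boolP (_ && _)) => [/andP[/andP[]]|_]; last by rewrite lee_fin.
  rewrite /G; case: ifP => [Nx W1 _ Bx|_ _]; last by rewrite ltxx.
  by rewrite lee_fin indicE mem_set//; exact: W_gt0.
- exact: emeasurable_funM.
- by move=> x; rewrite mule_ge0// lee_fin.
Qed.

Let IV2 : (\int[mu]_x ((s x)%:E * V2 x) <= e%:E)%E.
Proof.
apply: le_trans IE2; rewrite -rI.
- apply: mI => x; first by rewrite mule_ge0// lee_fin.
  have := s0 x; rewrite le_eqVlt => /orP[/eqP <-|sx]; first by rewrite !mul0e.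
  apply: lee_wpmul2l; first by rewrite lee_fin.
  rewrite /V2; case: (boolP (~~ B x)) => [Bx|_]; last by rewrite lee_fin.
  by rewrite lee_fin indicE mem_set//; exact: E2P.
- exact: emeasurable_funM.
- by move=> x; rewrite mule_ge0// lee_fin.
Qed.

(** A parametrised Cauchy-Schwarz inequality, obtained by integrating [G_le]: the second moment
    costs [lam * c], and the two tail events, far tasks and far data, cost [e / lam] each. *)
Lemma tail_majorant : exists G : X -> \bar R,
  [/\ measurable_fun setT G, (forall x, (0 <= G x)%E),
   (forall x, 0 < s x -> (evidence nu P pi x < +oo)%E ->
    (\int[nu]_y (pi y * (if f y || ~~ B x
       then P x y / fine (evidence nu P pi x) * Num.max (ln (P x y / q x)) 0
       else 0))%:E <= G x)%E),
   (forall x, 0 < s x -> evidence nu P pi x = +oo%E -> G x = +oo%E) &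
   (\int[mu]_x ((s x)%:E * G x) <= (lam * c + 2 * e / lam)%:E)%E].
Proof.
exists G; split => //.
- by move=> x sx Nx; rewrite /G {1}/N Nx.
- by move=> x sx Nx; rewrite /G {1}/N Nx ltxx.
have lV : 0 <= lam^-1 by rewrite invr_ge0 ltW.
have a1 : measurable_fun setT (fun x => (s x)%:E * (G x * G x))%E.
  by apply: emeasurable_funM => //; exact: emeasurable_funM.
have a2 : measurable_fun setT (fun x => (s x)%:E * V1 x)%E by exact: emeasurable_funM.
have a3 : measurable_fun setT (fun x => (s x)%:E * V2 x)%E by exact: emeasurable_funM.
have b1 x : (0 <= (s x)%:E * (G x * G x))%E by rewrite !mule_ge0// lee_fin.
have b2 x : (0 <= (s x)%:E * V1 x)%E by rewrite mule_ge0// lee_fin.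
have b3 x : (0 <= (s x)%:E * V2 x)%E by rewrite mule_ge0// lee_fin.
have mc (k : R) (h : X -> \bar R) : measurable_fun setT h ->
    measurable_fun setT (fun x => k%:E * h x)%E.
  by move=> mh; apply: emeasurable_funM => //; exact: measurable_cst.
have p1 x : (0 <= lam%:E * ((s x)%:E * (G x * G x)))%E by rewrite mule_ge0// lee_fin ltW.
have p2 x : (0 <= lam^-1%:E * ((s x)%:E * V1 x))%E by rewrite mule_ge0// lee_fin.
have p3 x : (0 <= lam^-1%:E * ((s x)%:E * V2 x))%E by rewrite mule_ge0// lee_fin.
have [m12 p12 F12] := ge0_integralTD mu (mc lam _ a1) (mc lam^-1 _ a2) p1 p2.
have [m13 p13 F13] := ge0_integralTD mu m12 (mc lam^-1 _ a3) p12 p3.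
apply: (@le_trans _ _ (\int[mu]_x (lam%:E * ((s x)%:E * (G x * G x)) +
   lam^-1%:E * ((s x)%:E * V1 x) + lam^-1%:E * ((s x)%:E * V2 x)))%E).
  apply: ge0_le_integralT => x; first by rewrite mule_ge0// lee_fin.
  have sx : (0 <= (s x)%:E)%E by rewrite lee_fin.
  apply: le_trans (lee_wpmul2l sx (G_le x)) _.
  have g1 : (0 <= lam%:E * (G x * G x))%E by rewrite !mule_ge0// lee_fin ltW.
  have g2 : (0 <= lam^-1%:E * V1 x)%E by rewrite mule_ge0// lee_fin.
  have g3 : (0 <= lam^-1%:E * V2 x)%E by rewrite mule_ge0// lee_fin.
  have g12 := adde_ge0 g1 g2.
  by rewrite ge0_muleDr// ge0_muleDr// !(muleCA (s x)%:E).
rewrite F13 F12 ge0_integralZl// ?lee_fin ?(ltW lam0)//.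
rewrite ge0_integralZl// ?lee_fin// ge0_integralZl// ?lee_fin//.
apply: (@le_trans _ _ (lam%:E * c%:E + lam^-1%:E * e%:E + lam^-1%:E * e%:E)%E).
  have le3 (a b d a' b' d' : \bar R) : (a <= a' -> b <= b' -> d <= d' ->
    a + b + d <= a' + b' + d')%E by move=> *; apply: leeD => //; exact: leeD.
  by apply: le3; apply: lee_wpmul2l; rewrite ?lee_fin ?(ltW lam0).
rewrite -!EFinM -!EFinD lee_fin; lra.
Qed.

End Tail.

(** * The likelihood model *)

Section Functionals.
Set Implicit Arguments.
Unset Strict Implicit.
Context {R : realType}.
Local Open Scope ereal_scope.

Lemma sint_ge0 d (X : measurableType d) (I : (X -> \bar R) -> \bar R)
    (mu : {measure set X -> \bar R}) g :
  represents I mu -> (forall x, 0 <= g x) -> sint I g = I g.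
Proof.
move=> rI g0; rewrite /sint.
rewrite (_ : (fun x => maxe (g x) 0) = g); last first.
  by apply/funext => x; rewrite max_l.
rewrite (_ : (fun x => maxe (- g x) 0) = cst 0); last first.
  by apply/funext => x; rewrite max_r// leeNl oppe0.
have -> : I (cst 0) = 0 by rewrite rI// integral0.
exact: sube0.
Qed.

(** Nothing is asked of [g], so the posterior risk can be bounded by a measurable majorant without
    being shown measurable itself. *)
Lemma sint_le_pos d (X : measurableType d) (I : (X -> \bar R) -> \bar R)
    (mu : {measure set X -> \bar R}) g :
  monotone_functional I -> represents I mu -> sint I g <= I (fun x => maxe (g x) 0).
Proof.
move=> mI rI; rewrite /sint geeDl// leeNl oppe0.
by apply: represents_ge0 rI _ => // x; rewrite le_max lexx orbT.
Qed.

Definition homogeneous_functional X (I : (X -> \bar R) -> \bar R) :=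
  forall (c : R) (f : X -> \bar R), (0 <= c)%R -> (forall x, 0 <= f x) ->
    I (fun x => c%:E * f x) = c%:E * I f.

(** Scaling the simple functions below [h] proves one inequality for every positive factor without
    measurability; the converse is the same inequality for [c^-1]. *)
Lemma homogeneous_integral d (X : measurableType d) (mu : {measure set X -> \bar R}) :
  homogeneous_functional (fun f => \int[mu]_x f x).
Proof.
move=> c f c0 f0; move: c0; rewrite le_eqVlt => /orP[/eqP <-|c0].
  by rewrite mul0e; under eq_integral do rewrite mul0e; rewrite integral0.
have le_mul (k : R) (h : X -> \bar R) : (0 < k)%R -> (forall x, 0 <= h x) ->
    k%:E * (\int[mu]_x h x) <= \int[mu]_x (k%:E * h x).
  move=> k0 h0.
  have kh0 x : 0 <= k%:E * h x by rewrite mule_ge0// lee_fin ltW.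
  rewrite muleC -lee_pdivlMr// [in X in X <= _]ge0_integralTE//.
  apply: ge_ereal_sup => _ [g /= gh <-].
  rewrite lee_pdivlMr// muleC -sintegralrM ge0_integralTE//.
  apply: ereal_sup_ubound; exists (scale_nnsfun g (ltW k0)) => // x.
  by rewrite /= EFinM; apply: lee_wpmul2l; [rewrite lee_fin ltW|exact: gh].
apply/eqP; rewrite eq_le le_mul// andbT.
have ci : (0 < c^-1)%R by rewrite invr_gt0.
have cf0 x : 0 <= c%:E * f x by rewrite mule_ge0// lee_fin ltW.
have := le_mul c^-1%R _ ci cf0.
have -> : (fun x => (c^-1)%:E * (c%:E * f x)) = f.
  by apply/funext => x; rewrite muleA -EFinM mulVf ?gt_eqF// mul1e.
by rewrite muleC lee_pdivrMr// muleC.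
Qed.

Lemma homogeneous_itint X (I : (X -> \bar R) -> \bar R) n :
  homogeneous_functional I -> (forall f, (forall x, 0 <= f x) -> 0 <= I f) ->
  homogeneous_functional (@itint R X I n) /\
  (forall f, (forall x, 0 <= f x) -> 0 <= @itint R X I n f).
Proof.
move=> hI I0; elim: n => [|n [IHh IH0]]; first by split => [c f|f] //= ; apply.
split => [c f c0 f0|f f0] /=; last by apply: I0 => x; exact: IH0.
rewrite -hI//; last by move=> x; exact: IH0.
by congr I; apply/funext => x; rewrite IHh.
Qed.

Lemma homogeneous_leb n : homogeneous_functional (@leb R n) /\
  (forall f, (forall x, 0 <= f x) -> 0 <= @leb R n f).
Proof.
apply: homogeneous_itint.
  exact: (@homogeneous_integral _ (measurableTypeR R) lebesgue_measure).
by move=> f f0; apply: integral_ge0 => x _.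
Qed.

End Functionals.

Section Likelihood.
Set Implicit Arguments.
Unset Strict Implicit.
Context {R : realType} (d dz : nat).
Variables (Theta : set (@vec R d)) (p : seq (@vec R dz) -> @vec R dz -> @vec R d -> R).
Hypothesis p_ge0 : forall hist z th, Theta th -> 0 <= p hist z th.

Lemma pT_ge0 T (zs : T.-tuple (vec dz)) th : Theta th -> 0 <= pT p zs th.
Proof. by move=> Th; apply: prodr_ge0 => t _; exact: p_ge0. Qed.

Lemma enorm_ge0 n (x : @vec R n) : 0 <= enorm x.
Proof. exact: sqrtr_ge0. Qed.

(** Generalising over the past [h] drives the induction: given the first sample, the later factors
    integrate to one, so only the density of that sample remains. Homogeneity pulls it out without
    any measurability of the sections. *)
Lemma lebZ_pT T th : Theta th ->
  (forall hist th, Theta th -> leb (fun z => (p hist z th)%:E) = 1%E) ->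
  lebZ (fun zs : T.-tuple (vec dz) => (pT p zs th)%:E) = 1%E.
Proof.
move=> Th p1.
pose F (h : seq (vec dz)) n (zs : n.-tuple (vec dz)) :=
  (\prod_(t < n) p (h ++ take t zs) (tnth zs t) th)%:E.
suff FE n h : itint (@leb R dz) (F h n) = 1%E.
  by rewrite /lebZ -(FE T [::]).
have [hleb leb0] := homogeneous_leb (R := R) dz.
elim: n h => [|n IH] h /=; first by rewrite /F big_ord0.
have [hit it0] := homogeneous_itint n hleb leb0.
rewrite -(p1 h th Th); congr leb; apply/funext => x.
have -> : (fun t : n.-tuple (vec dz) => F h n.+1 [tuple of x :: t]) =
    (fun t => (p h x th)%:E * F (rcons h x) n t)%E.
  apply/funext => t; rewrite /F -EFinM big_ord_recl/= cats0 tnth0; congr (_ * _)%:E.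
  by apply: eq_bigr => i _; rewrite tnthS cat_rcons.
rewrite hit ?p_ge0//; first by rewrite IH mule1.
by move=> t; rewrite lee_fin; apply: prodr_ge0 => i _; exact: p_ge0.
Qed.

Section Regularity.
Variables (c : R) (m : nat).
Hypothesis regular : forall (t : nat) (Rr : R) (th th' : @vec R d),
  (1 <= t)%N -> 0 < Rr ->
  Theta th -> enorm th <= Rr -> Theta th' -> enorm th' <= Rr ->
  forall (hist : (t.-1).-tuple (vec dz)) (z : vec dz),
    (forall i, enorm (tnth hist i) <= Rr) -> enorm z <= Rr ->
    (elogratio (p hist z th) (p hist z th') <= (polyb c m Rr * Defs.edist th th')%:E)%E.

Let regular_seq (Rr : R) th th' (hist : seq (vec dz)) z : 0 < Rr ->
  Theta th -> enorm th <= Rr -> Theta th' -> enorm th' <= Rr ->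
  (forall v, v \in hist -> enorm v <= Rr) -> enorm z <= Rr ->
  (elogratio (p hist z th) (p hist z th') <= (polyb c m Rr * Defs.edist th th')%:E)%E.
Proof.
move=> R0 Th hth Th' hth' hh hz.
apply: (@regular (size hist).+1 Rr th th' isT R0 Th hth Th' hth' (in_tuple hist) z) => //.
by move=> i; apply: hh; exact: mem_tnth.
Qed.

(** If only the second density vanished, [elogratio] would be [+oo]; but regularity on a ball
    containing both tasks, the history and the sample bounds it by a real number. *)
Lemma common_support hist z th th' : Theta th -> Theta th' ->
  0 < p hist z th -> 0 < p hist z th'.
Proof.
move=> Th Th' pth; rewrite lt_neqAle p_ge0// andbT eq_sym; apply/negP => /eqP p0.
pose Rr := 1 + enorm th + enorm th' + enorm z + \sum_(v <- hist) enorm v.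
have S0 : 0 <= \sum_(v <- hist) enorm v by apply: sumr_ge0 => v _; exact: enorm_ge0.
have e1 := enorm_ge0 th; have e2 := enorm_ge0 th'; have e3 := enorm_ge0 z.
have := @regular_seq Rr th th' hist z; rewrite /elogratio pth p0 ltxx /= => H.
suff : (+oo <= (polyb c m Rr * Defs.edist th th')%:E)%E by rewrite leye_eq.
apply: H => //; rewrite /Rr; try lra.
move=> v vh; rewrite (big_rem v)//=.
have : 0 <= \sum_(y <- rem v hist) enorm y by apply: sumr_ge0 => w _; exact: enorm_ge0.
lra.
Qed.

Lemma pT_factor_gt0 T (zs : T.-tuple (vec dz)) th (t : 'I_T) : Theta th ->
  0 < pT p zs th -> 0 < p (take t zs) (tnth zs t) th.
Proof.
move=> Th pth; have := p_ge0 (take t zs) (tnth zs t) Th.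
rewrite le_eqVlt => /orP[/eqP p0|//]; move: pth.
by rewrite /pT (bigD1 t)//= -p0 mul0r ltxx.
Qed.

Lemma pT_gt0 T (zs : T.-tuple (vec dz)) th th' : Theta th -> Theta th' ->
  0 < pT p zs th -> 0 < pT p zs th'.
Proof.
move=> Th Th' pth; apply: prodr_gt0 => t _.
exact: common_support Th Th' (pT_factor_gt0 t Th pth).
Qed.

Lemma pT_lipschitz (Rr : R) T (zs : T.-tuple (vec dz)) th th' : 0 < Rr ->
  Theta th -> enorm th <= Rr -> Theta th' -> enorm th' <= Rr ->
  (forall t, enorm (tnth zs t) <= Rr) -> 0 < pT p zs th ->
  ln (pT p zs th / pT p zs th') <= T%:R * (polyb c m Rr * Defs.edist th th').
Proof.
move=> R0 Th hth Th' hth' hz pth; have pth' := pT_gt0 Th Th' pth.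
set b := polyb c m Rr * Defs.edist th th'.
have pt (t : 'I_T) : 0 < p (take t zs) (tnth zs t) th by exact: pT_factor_gt0.
have pt' (t : 'I_T) : 0 < p (take t zs) (tnth zs t) th' by exact: common_support Th Th' (pt t).
have le_t (t : 'I_T) : p (take t zs) (tnth zs t) th <= expR b * p (take t zs) (tnth zs t) th'.
  have := @regular_seq Rr th th' (take t zs) (tnth zs t) R0 Th hth Th' hth'.
  rewrite /elogratio pt pt' /= lee_fin => H.
  rewrite -ler_pdivrMr// -[leLHS]lnK ?posrE ?divr_gt0// ler_expR; apply: H => //.
  by move=> v /mem_take /tnthP[i ->].
have : pT p zs th <= expR b ^+ T * pT p zs th'.
  have -> : expR b ^+ T * pT p zs th' = \prod_(t < T) (expR b * p (take t zs) (tnth zs t) th').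
    by rewrite big_split/= prodr_const card_ord.
  by apply: ler_prod => t _; rewrite le_t ltW.
rewrite -ler_pdivrMr// => h; rewrite -ler_expR lnK ?posrE ?divr_gt0//.
by rewrite expRM_natl.
Qed.

End Regularity.
End Likelihood.

Section ModelMeasurability.
Set Implicit Arguments.
Unset Strict Implicit.
Context {R : realType} (d dz : nat).
Variables (Theta : set (@vec R d)) (ths : @vec R d).
Hypotheses (mTheta : measurable Theta) (Tths : Theta ths).

(* Making every function of the task total, so that integrals range over the whole space. *)
Definition retract th : vec d := if th \in Theta then th else ths.

Lemma retract_in th : Theta (retract th).
Proof. by rewrite /retract; case: ifPn => // /set_mem. Qed.

Lemma retract_id th : Theta th -> retract th = th.
Proof. by move=> Th; rewrite /retract mem_set. Qed.

Lemma measurable_mem_set e (X : measurableType e) (A : set X) :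
  measurable A -> measurable_fun setT (fun x => x \in A).
Proof.
move=> mA; rewrite (_ : (fun x => _) = fun x => 0 < \1_A x :> R).
  by apply: measurable_fun_ltr; [exact: measurable_cst|exact: measurable_indic].
by apply/funext => x; rewrite indicE; case: (x \in A); rewrite ?ltr01 ?ltxx.
Qed.

Lemma measurable_retract : measurable_fun setT retract.
Proof.
apply: measurable_fun_ifT; first exact: measurable_mem_set.
- exact: measurable_id.
- exact: measurable_cst.
Qed.

Lemma measurable_enorm n : measurable_fun setT (@enorm R n).
Proof.
rewrite (_ : @enorm R n = fun x => (\sum_(i < n) tnth x i ^+ 2) `^ 2^-1).
  apply: (measurableT_comp (measurable_powR _)); apply: measurable_sum => i.
  by apply: measurable_funX; exact: measurable_tnth.
apply/funext => x; rewrite powR12_sqrt//; apply: sumr_ge0 => i _; exact: sqr_ge0.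
Qed.

Variable p : seq (@vec R dz) -> @vec R dz -> @vec R d -> R.
Hypothesis mp : forall t : nat,
  measurable_fun (setT `*` Theta)
    (fun x : (t.+1).-tuple (@vec R dz) * @vec R d =>
      p (take t x.1) (tnth x.1 ord_max) x.2).

Lemma measurable_pT T : measurable_fun setT
  (fun z : T.-tuple (@vec R dz) * @vec R d => pT p z.1 (retract z.2)).
Proof.
apply: measurable_prod => t _.
(* [mp] concerns the last sample of a [t.+1]-tuple, so the factor of index [t] is evaluated on the
   first [t.+1] coordinates. *)
pose h (x : T.-tuple (@vec R dz)) : (t.+1).-tuple (@vec R dz) :=
  [tuple tnth x (widen_ord (ltn_ord t) i) | i < t.+1].
pose g (z : T.-tuple (@vec R dz) * @vec R d) : (t.+1).-tuple (@vec R dz) * @vec R d :=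
  (h z.1, retract z.2).
rewrite (_ : (fun z => _) = (fun x : (t.+1).-tuple (@vec R dz) * @vec R d =>
    p (take t x.1) (tnth x.1 ord_max) x.2) \o g).
  apply: (@measurable_comp _ _ _ _ _ _ (setT `*` Theta)
    (fun x : (t.+1).-tuple (@vec R dz) * @vec R d =>
      p (take t x.1) (tnth x.1 ord_max) x.2) setT g).
  - exact: measurableX.
  - by move=> _ [z _ <-]; split => //; exact: retract_in.
  - exact: mp.
  - apply: measurable_fun_pair; last first.
      by apply: measurableT_comp => //; exact: measurable_retract.
    apply/measurable_fun_tnthP => i.
    rewrite (_ : _ \o _ = fun z => tnth z.1 (widen_ord (ltn_ord t) i)); last first.
      by apply/funext => z /=; rewrite tnth_mktuple.
    by apply: (@measurableT_comp _ _ _ _ _ _ (fun x => tnth x _)) => //; exact: measurable_tnth.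
apply/funext => z /=; rewrite [tnth (h _) _]tnth_mktuple; congr p; last first.
  by apply: (congr1 (tnth z.1)); exact: val_inj.
have x0 : vec dz := tnth z.1 t.
refine (@eq_from_nth _ x0 _ _ _ _).
  by rewrite !size_take !size_tuple card_ord ltn_ord ltnSn.
move=> i; rewrite size_take size_tuple ltn_ord => it.
rewrite !nth_take//.
have iT : (i < T)%N by rewrite (ltn_trans it).
have it1 : (i < t.+1)%N by rewrite ltnS ltnW.
rewrite -(tnth_nth x0 z.1 (Ordinal iT)) -(tnth_nth x0 (h z.1) (Ordinal it1)).
by rewrite tnth_mktuple; apply: (congr1 (tnth z.1)); exact: val_inj.
Qed.

Lemma coord_le_enorm n (x : @vec R n) i : `|tnth x i| <= enorm x.
Proof.
rewrite -sqrtr_sqr; apply: ler_wsqrtr; rewrite (bigD1 i)//= lerDl.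
by apply: sumr_ge0 => j _; exact: sqr_ge0.
Qed.

(** Grid points may fall outside [Theta] or the ball, so each cell is represented by one of its own
    tasks; [ths] is the default for empty cells. Coordinates of two tasks of one cell have the same
    integer part after shifting by [Rr] and dividing by [h], hence differ by at most [h]. *)
Lemma grid_cover (Rr h : R) : 0 < Rr -> 0 < h ->
  exists (I : finType) (c : I -> vec d),
  [/\ (forall i, Theta (c i)),
    (forall th, Theta th -> enorm th < Rr -> exists i, enorm (c i) < Rr /\
       Defs.edist th (c i) <= h * (1 + d%:R) /\ Defs.edist (c i) th <= h * (1 + d%:R)) &
    #|I|%:R <= (2 * Rr / h + 1) ^+ d].
Proof.
move=> R0 h0; pose K := Num.trunc (2 * Rr / h).
have b0 : 0 <= 2 * Rr / h by rewrite divr_ge0 ?mulr_ge0 ?ltW.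
have /andP[K1 K2] := truncn_itv b0.
pose cell (th : vec d) : {ffun 'I_d -> 'I_K.+1} :=
  [ffun i => inord (Num.trunc ((tnth th i + Rr) / h))].
pose A (k : {ffun 'I_d -> 'I_K.+1}) := [set th | [/\ Theta th, enorm th < Rr & cell th = k]].
exists {ffun 'I_d -> 'I_K.+1}, (fun k => xget ths (A k)); split.
- by move=> k; case: xgetP => // th _ [].
- move=> th Th hth; exists (cell th).
  have : A (cell th) (xget ths (A (cell th))) by apply: xgetPex; exists th.
  move: (xget _ _) => y [Ty hy cy]; split => //.
  have close i : `|tnth th i - tnth y i| <= h.
    have := congr1 (fun f : {ffun 'I_d -> 'I_K.+1} => nat_of_ord (f i)) cy.
    rewrite !ffunE.
    have bnd (z : vec d) : enorm z < Rr -> exists t,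
        [/\ t = Num.trunc ((tnth z i + Rr) / h), (t < K.+1)%N &
          t%:R * h <= tnth z i + Rr < t.+1%:R * h].
      move=> hz; have := le_lt_trans (coord_le_enorm z i) hz; rewrite ltr_norml => /andP[z1 z2].
      have a0 : 0 <= (tnth z i + Rr) / h by rewrite divr_ge0 ?ltW//; lra.
      have /andP[t1 t2] := truncn_itv a0.
      exists (Num.trunc ((tnth z i + Rr) / h)); split => //.
        rewrite -(ltr_nat R); apply: le_lt_trans K2; apply: le_trans t1 _.
        by rewrite ler_pM2r ?invr_gt0//; lra.
      by rewrite -ler_pdivlMr// -ltr_pdivrMr// t1 t2.
    have [t [<- tK /andP[t1 t2]]] := bnd y hy.
    have [t' [<- tK' /andP[t1' t2']]] := bnd th hth.
    rewrite !inordK// => tt'; subst t'.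
    rewrite ler_norml; move: t2 t2'; rewrite -natr1 mulrDl mul1r => t2 t2'.
    by apply/andP; split; lra.
  (* The factor [1 + d] stands for the square root of [d], by [d <= (1 + d) ^ 2]. *)
  have dist_le (a b : vec d) : (forall i, `|tnth a i - tnth b i| <= h) ->
      Defs.edist a b <= h * (1 + d%:R).
    move=> ab; rewrite /Defs.edist.
    have hd : 0 <= h * (1 + d%:R) by rewrite mulr_ge0 ?addr_ge0// ltW.
    rewrite -(ger0_norm hd) -sqrtr_sqr; apply: ler_wsqrtr.
    apply: (@le_trans _ _ (\sum_(i < d) h ^+ 2)).
      apply: ler_sum => i _; rewrite -[leLHS]ger0_norm ?sqr_ge0// normrX.
      by apply: lerXn2r; rewrite ?nnegrE ?(ltW h0).
    rewrite sumr_const card_ord -(mulr_natr (h ^+ 2)) exprMn.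
    apply: ler_wpM2l; first exact: sqr_ge0.
    have d0 : 0 <= d%:R :> R by exact: ler0n.
    rewrite expr2; nra.
  by split; apply: dist_le => // i; rewrite distrC.
rewrite card_ffun !card_ord natrX; apply: lerXn2r.
- by rewrite nnegrE.
- by rewrite nnegrE addr_ge0.
- by rewrite -natr1 lerD2r.
Qed.

End ModelMeasurability.

(** * The oracle inequality *)

Section Oracle.
Set Implicit Arguments.
Unset Strict Implicit.
Context {R : realType} dX dY (X : measurableType dX) (Y : measurableType dY).
Variables (mu : {sigma_finite_measure set X -> \bar R}).
Variables (nu : {sigma_finite_measure set Y -> \bar R}).
Variables (P : X -> Y -> R) (s q : X -> R) (pi : Y -> R).
Hypotheses (mP : measurable_fun setT (fun z : X * Y => P z.1 z.2))
  (ms : measurable_fun setT s) (mq : measurable_fun setT q)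
  (mpi : measurable_fun setT pi).
Hypotheses (P0 : forall x y, 0 <= P x y) (s0 : forall x, 0 <= s x)
  (q0 : forall x, 0 <= q x) (pi0 : forall y, 0 <= pi y).
Hypotheses (P_gt0 : forall x y, 0 < s x -> 0 < P x y)
  (q_gt0 : forall x, 0 < s x -> 0 < q x).
Hypotheses (intP : forall y, (\int[mu]_x (P x y)%:E <= 1)%E)
  (ints : (\int[mu]_x (s x)%:E = 1)%E) (intq : (\int[mu]_x (q x)%:E <= 1)%E)
  (intpi : (\int[nu]_y (pi y)%:E = 1)%E).

Variables (I : (X -> \bar R) -> \bar R).
Hypotheses (mI : monotone_functional I) (rI : represents I mu).
Variables (f : Y -> bool) (B : X -> bool) (S : X -> \bar R) (E1 E2 : set X).
Variables (c e lam r : R).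
Hypotheses (mf : measurable_fun setT f) (mB : measurable_fun setT B)
  (S0 : forall x, 0 < s x -> (0 <= S x)%E)
  (S_ge : forall x y, 0 < s x -> ((ln (P x y / q x))%:E <= S x)%E)
  (E1P : forall x y, 0 < s x -> B x -> f y -> q x < P x y -> E1 x)
  (E2P : forall x, 0 < s x -> ~~ B x -> E2 x)
  (IS : (I (fun x => (s x)%:E * (S x * S x)) <= c%:E)%E)
  (IE1 : (I (fun x => (s x)%:E * (\1_E1 x)%:E) <= e%:E)%E)
  (IE2 : (I (fun x => (s x)%:E * (\1_E2 x)%:E) <= e%:E)%E)
  (lam0 : 0 < lam) (e1 : e <= 2^-1) (r01 : 0 < r < 1).
Variables (J : finType) (k : J -> Y).
Hypothesis cover : forall y, ~~ f y -> exists j, forall x, B x -> 0 < s x ->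
  `|ln (P x y / P x (k j))| <= 2^-1.

Let r0 : 0 < r. Proof. by case/andP: r01. Qed.

Definition divergence y := - ln (fine (affinity mu s r xpredT (P ^~ y))).

Let mPy y : measurable_fun setT (P ^~ y). Proof. exact: measurable_section2. Qed.

Let adm y : admissible mu s (P ^~ y).
Proof. by split => // x; exact: P_gt0. Qed.

Let intT : (0 < \int[mu]_x (s x * (xpredT x)%:R)%:E)%E.
Proof. by under eq_integral do rewrite mulr1; rewrite ints. Qed.

Let aff_gt0 y : (0 < affinity mu s r xpredT (P ^~ y))%E.
Proof. exact: affinity_gt0. Qed.

Lemma affinityE y :
  affinity mu s r xpredT (P ^~ y) = (fine (affinity mu s r xpredT (P ^~ y)))%:E.
Proof.
rewrite fineK// ge0_fin_numE; last exact: ltW.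
by apply: le_lt_trans (affinity_le1 ms s0 ints r01 _ (adm y)) _; rewrite ltry.
Qed.

Lemma affinity_fine_gt0 y : 0 < fine (affinity mu s r xpredT (P ^~ y)).
Proof. by rewrite -lte_fin -affinityE. Qed.

Lemma affinity_divergence y : affinity mu s r xpredT (P ^~ y) = (expR (- divergence y))%:E.
Proof. by rewrite affinityE /divergence opprK lnK// posrE affinity_fine_gt0. Qed.

Lemma divergence_ge0 y : 0 <= divergence y.
Proof.
rewrite oppr_ge0 ln_le0// -lee_fin -affinityE.
exact: affinity_le1 (adm y).
Qed.

Let mPs : measurable_fun setT (fun z : X * Y => s z.1 * expR (r * ln (P z.1 z.2 / s z.1))).
Proof.
apply: measurable_funM; first exact: measurableT_comp.
apply: measurable_fun_expR; apply: measurable_funM => //; apply: measurable_fun_ln.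
by apply: measurable_fun_div => //; exact: measurableT_comp.
Qed.

Lemma measurable_divergence : measurable_fun setT divergence.
Proof.
apply: measurable_funN; apply: measurable_fun_ln; apply: measurableT_comp => //.
apply: (@measurable_integral1 R _ _ _ _ mu (fun x y => (s x * expR (r * ln (P x y / s x)))%:E)).
  exact/measurable_EFinP.
by move=> x y; rewrite lee_fin mulr_ge0// expR_ge0.
Qed.

Let normalized y :
  (\int[mu]_x (s x * expR (r * ln (P x y / s x) + divergence y))%:E <= 1)%E.
Proof.
have E x : ((s x * expR (r * ln (P x y / s x) + divergence y))%:E =
    (expR (divergence y))%:E * (s x * expR (r * ln (P x y / s x)))%:E)%E.
  by rewrite -EFinM expRD; congr EFin; ring.
under eq_integral do rewrite E.
have mi : measurable_fun setT (fun x => (s x * expR (r * ln (P x y / s x)))%:E).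
  apply/measurable_EFinP.
  exact: (@measurable_section2 _ _ _ _ _ _ (fun x y => s x * expR (r * ln (P x y / s x)))).
rewrite ge0_integralZl ?lee_fin ?expR_ge0//; last first.
  by move=> x _; rewrite lee_fin mulr_ge0// expR_ge0.
rewrite -[(\int[mu]_x _)%E]/(affinity mu s r xpredT (P ^~ y)) affinity_divergence.
by rewrite -EFinM -expRD subrr expR0.
Qed.

Let mse : measurable_fun setT (EFin \o s). Proof. exact/measurable_EFinP. Qed.

Let mbool (b : X -> bool) : measurable_fun setT b ->
  measurable_fun setT (fun x => (s x * (b x)%:R)%:E).
Proof.
move=> mb; apply/measurable_EFinP; apply: measurable_funM => //.
rewrite (_ : (fun x => _) = fun x => (if b x then 1 else 0 : R)).
  by apply: measurable_fun_ifT => //; exact: measurable_cst.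
by apply/funext => x; case: (b x).
Qed.

(** The complement of [B] lies in [E2] up to points where [s] vanishes, and has probability at most
    [e <= 1 / 2]. Positivity of [B] allows division by the affinities restricted to it. *)
Let intB : (0 < \int[mu]_x (s x * (B x)%:R)%:E)%E.
Proof.
have mnB : measurable_fun setT (fun x => (s x * (~~ B x)%:R)%:E).
  by apply: (mbool (b := fun x => ~~ B x)); exact: measurable_neg.
have p1 x : (0 <= (s x * (B x)%:R)%:E)%E by rewrite lee_fin mulr_ge0.
have p2 x : (0 <= (s x * (~~ B x)%:R)%:E)%E by rewrite lee_fin mulr_ge0.
have [_ _] := ge0_integralTD mu (mbool mB) mnB p1 p2.
have -> : (fun x => (s x * (B x)%:R)%:E + (s x * (~~ B x)%:R)%:E)%E = EFin \o s.
  by apply/funext => x /=; rewrite -EFinD -mulrDr; case: (B x); rewrite /= ?addr0 ?add0r mulr1.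
rewrite [LHS]ints => H; rewrite lt_neqAle integral_ge0// andbT.
apply/negP => /eqP H0; move: H; rewrite -H0 add0e => H.
have : (1%:E <= (2^-1)%:E :> \bar R)%E.
  rewrite H; apply: (@le_trans _ _ e%:E); last by rewrite lee_fin.
  apply: le_trans IE2; rewrite -rI//; apply: mI => // x.
  have := s0 x; rewrite le_eqVlt => /orP[/eqP <-|sx]; first by rewrite mul0r mul0e.
  rewrite -EFinM lee_fin; apply: ler_wpM2l => //.
  by case: (boolP (~~ B x)) => //= Bx; rewrite indicE mem_set//; exact: E2P.
by rewrite lee_fin; lra.
Qed.

Let pos_part (h : X -> R) : \bar R := (\int[mu]_x (s x * Num.max (h x) 0)%:E)%E.

(** By [h <= 1 + h ^ 2] and the second moment of [S]. This makes [lp y] finite uniformly in [y], and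
    with it the prior mass. *)
Lemma log_gain_le y : (pos_part (fun x => ln (P x y / q x))%R <= (1 + c)%:E)%E.
Proof.
pose h x := Num.max (ln (P x y / q x)) 0.
have h0 x : 0 <= h x by rewrite le_max lexx orbT.
have mh : measurable_fun setT h.
  by apply: measurable_maxr => //; apply: measurable_fun_ln; exact: measurable_fun_div.
have m2 : measurable_fun setT (fun x => (s x * (h x * h x))%:E).
  by apply/measurable_EFinP; do 2 apply: measurable_funM => //.
have p1 x : (0 <= (s x)%:E)%E by rewrite lee_fin.
have p2 x : (0 <= (s x * (h x * h x))%:E)%E by rewrite lee_fin !mulr_ge0.
have [_ _ H] := ge0_integralTD mu mse m2 p1 p2.
apply: (@le_trans _ _ (\int[mu]_x ((s x)%:E + (s x * (h x * h x))%:E))%E).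
  apply: ge0_le_integralT => x; first by rewrite lee_fin mulr_ge0//; exact: h0.
  rewrite -EFinD lee_fin -/(h x) -{2}(mulr1 (s x)) -mulrDr; apply: ler_wpM2l => //.
  have := sqr_ge0 (h x - 2^-1); rewrite expr2; nra.
rewrite H EFinD; apply: leeD; first by rewrite [X in (X <= _)%E]ints.
apply: le_trans IS; rewrite -rI//; apply: mI => // x.
have := s0 x; rewrite le_eqVlt => /orP[/eqP <-|sx]; first by rewrite mul0r mul0e.
rewrite EFinM; apply: lee_wpmul2l => //; rewrite EFinM.
have hS : ((h x)%:E <= S x)%E.
  by rewrite /h EFin_max ge_max S_ge//= S0.
by apply: lee_pmul; rewrite ?lee_fin.
Qed.

Let g := lam * c + 2 * e / lam.
Let klp := pos_part (fun x => ln (s x / q x)).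
Let klm := pos_part (fun x => - ln (s x / q x)).
Let lp y := pos_part (fun x => ln (P x y / q x)).
Let lm y := pos_part (fun x => - ln (P x y / q x)).

(** The 4 adds the 2 of [integral_cover_loss] to that of [posterior_risk_majorant]. The tail cost
    [g] enters once through the posterior weights and once, with factor [1 + r], through the mixture
    loss. *)
Lemma oracle_majorant : exists F : X -> \bar R,
  [/\ measurable_fun setT F, (forall x, (0 <= F x)%E),
    (forall x, 0 < s x -> (evidence nu P pi x < +oo)%E ->
      ((s x)%:E * (\int[nu]_y (pi y * P x y * divergence y)%:E *
        ((fine (evidence nu P pi x))^-1)%:E) <= F x)%E),
    (forall x, 0 < s x -> evidence nu P pi x = +oo%E -> F x = +oo%E) &
    forall M, 0 < M -> (klp < +oo)%E ->
      (\int[nu]_y ((pi y)%:E * expeR (- (lm y - lp y))) = M%:E)%E ->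
      (\int[mu]_x F x <= (4 + ln (1 + #|J|%:R) + g + r)%:E +
        (1 + r)%:E * ((g + 2 - ln M)%:E + (klp - klm)))%E].
Proof.
have [G [mG G0 G_ge G_oo intG]] := tail_majorant mP ms mq mpi P0 s0 q0 pi0 P_gt0 q_gt0
  intpi mI rI mf mB S0 S_ge E1P E2P IS IE1 IE2 lam0.
pose Q j x := P x (k j).
have admQ j : admissible mu s (Q j) by exact: adm.
pose U := cover_loss mu s r Q B.
have mU : measurable_fun setT U by exact: measurable_cover_loss.
have U0 x : 0 <= U x by exact: (cover_loss_ge0 ms s0 ints r01 mB admQ intB).
have intU := integral_cover_loss ms s0 ints r01 mB admQ intB.
pose b x y := f y || ~~ B x.
have mb : measurable_fun setT (fun z : X * Y => b z.1 z.2).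
  apply: measurable_or; first exact: measurableT_comp.
  by apply: measurable_neg; exact: measurableT_comp.
have D_le x y : 0 < s x -> ~~ b x y -> divergence y <= U x + r * ln (s x / P x y).
  move=> sx; rewrite negb_or negbK => /andP[fy Bx].
  have [j jP] := cover fy.
  exact: (cover_loss_dominates ms s0 ints r01 mB admQ intB (adm y) jP (affinity_divergence y)).
have [F [mF F0 F_ge F_oo intF]] := posterior_risk_majorant mP ms mq mpi P0 s0 q0 pi0
  P_gt0 q_gt0 ints intq intpi (ltW r0) mb measurable_divergence divergence_ge0 mU U0 mG G0
  D_le normalized G_ge G_oo intU intG.
exists F; split => // M M0 klp_oo intM; apply: (le_trans intF).
have EL := mixture_loss_le mP ms mq mpi P0 s0 q0 pi0 P_gt0 q_gt0 intP ints intq intpi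
  mG G0 G_oo intG klp_oo log_gain_le M0 intM.
have r1 : (0 <= (1 + r)%:E)%E by rewrite lee_fin addr_ge0// ltW.
by apply: leeD; [rewrite lee_fin /g; lra|exact: lee_wpmul2l].
Qed.

End Oracle.

Section FixedHorizonTools.
Set Implicit Arguments.
Unset Strict Implicit.
Context {R : realType}.

Lemma measurable_fun_expeR d (X : measurableType d) (f : X -> \bar R) :
  measurable_fun setT f -> measurable_fun setT (fun x => expeR (f x)).
Proof.
move=> mf; rewrite (_ : (fun x => _) = fun x =>
    if (f x < +oo)%E then (if (-oo < f x)%E then (expR (fine (f x)))%:E else 0%E) else +oo%E).
  apply: measurable_fun_ifT; [exact: measurable_fun_lte| |exact: measurable_cst].
  apply: measurable_fun_ifT; [exact: measurable_fun_lte| |exact: measurable_cst].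
  by apply/measurable_EFinP; apply: measurable_fun_expR; exact: measurableT_comp.
by apply/funext => x; case: (f x) => [a| |] //=; rewrite ltry ltNyr.
Qed.

Lemma prod_powR (I : finType) (r : R) (x : I -> R) : (forall i, 0 <= x i) ->
  \prod_i x i `^ r = (\prod_i x i) `^ r.
Proof.
move=> x0; suff [] : \prod_i x i `^ r = (\prod_i x i) `^ r /\ 0 <= \prod_i x i by [].
elim/big_rec2: _ => [|i a b _ [-> b0]]; first by rewrite powR1.
by rewrite powRM// mulr_ge0.
Qed.

Lemma maxr_mul_pos (a b : R) : 0 <= a -> maxe (a * b)%:E 0%E = (a * Num.max b 0)%:E.
Proof. by move=> a0; rewrite -EFin_max maxr_pMr// mulr0. Qed.

Lemma bounded_tuple_measurable n T (Rr : R) :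
  measurable_fun setT (fun zs : T.-tuple (@vec R n) => [forall t, enorm (tnth zs t) < Rr]).
Proof.
(* The conjunction over samples is read as positivity of a product of indicators. *)
rewrite (_ : (fun zs => _) = fun zs : T.-tuple (@vec R n) =>
    0 < \prod_(t < T) (if enorm (tnth zs t) < Rr then 1 else 0 : R)).
  apply: measurable_fun_ltr; first exact: measurable_cst.
  apply: measurable_prod => t _; apply: measurable_fun_ifT => //.
  - apply: measurable_fun_ltr; last exact: measurable_cst.
    by apply: measurableT_comp; [exact: measurable_enorm|exact: measurable_tnth].
apply/funext => zs; apply/forallP/idP => [H|H t].
  by apply: prodr_gt0 => t _; rewrite H.
by move: H; rewrite (bigD1 t)//=; case: ifP => //; rewrite mul0r ltxx.
Qed.

End FixedHorizonTools.

(** * The bound at a fixed horizon *)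

Section FixedHorizon.
Set Implicit Arguments.
Unset Strict Implicit.
Context {R : realType} (d dz : nat).
Variables (Theta : set (@vec R d)) (p : seq (@vec R dz) -> @vec R dz -> @vec R d -> R).
Variables (ths thb : @vec R d).
Hypotheses (mTheta : measurable Theta)
  (p_ge0 : forall hist z th, Theta th -> 0 <= p hist z th)
  (p_int : forall hist th, Theta th -> leb (fun z => (p hist z th)%:E) = 1%E)
  (mp : forall t : nat, measurable_fun (setT `*` Theta)
    (fun x : (t.+1).-tuple (@vec R dz) * @vec R d =>
      p (take t x.1) (tnth x.1 ord_max) x.2))
  (Tths : Theta ths) (Tthb : Theta thb).
Variables (c0 : R) (m0 : nat).
Hypothesis regular : forall (t : nat) (Rr : R) (th th' : @vec R d),
  (1 <= t)%N -> 0 < Rr ->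
  Theta th -> enorm th <= Rr -> Theta th' -> enorm th' <= Rr ->
  forall (hist : (t.-1).-tuple (vec dz)) (z : vec dz),
    (forall i, enorm (tnth hist i) <= Rr) -> enorm z <= Rr ->
    (elogratio (p hist z th) (p hist z th') <= (polyb c0 m0 Rr * Defs.edist th th')%:E)%E.
Variables (r : R) (r01 : 0 < r < 1).
Variable prior : @vec R d -> R.
Hypotheses (mprior : measurable_fun Theta prior)
  (prior0 : forall th, Theta th -> 0 <= prior th)
  (prior1 : intTheta Theta (fun th => (prior th)%:E) = 1%E).
Variables (T : nat) (T1 : (1 <= T)%N).
Variables (c e lam Rr L h : R).
Hypotheses (Rr0 : 0 < Rr) (h0 : 0 < h) (lam0 : 0 < lam) (e1 : e <= 2^-1)
  (L0 : 0 <= L) (polyL : polyb c0 m0 Rr <= L)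
  (small : T%:R * (L * (h * (1 + d%:R))) <= 2^-1).
Let S (zs : T.-tuple (@vec R dz)) : \bar R :=
  ereal_sup [set elogratio (pT p zs th) (pT p zs thb) | th in Theta].
Hypotheses (moment : (EZ p ths (fun zs => S zs * S zs) <= c%:E)%E)
  (tail1 : (PZ p ths (fun zs : T.-tuple (@vec R dz) =>
      (ereal_sup [set (pT p zs th)%:E | th in [set th | Theta th /\ (Rr <= enorm th)%R]]
         >= (pT p zs thb)%:E)%E) <= e%:E)%E)
  (tail2 : (PZ p ths (fun zs : T.-tuple (@vec R dz) =>
      exists t : 'I_T, (Rr <= enorm (tnth zs t))%R) <= e%:E)%E).

Let X := T.-tuple (@vec R dz).
Let P (zs : X) y := pT p zs (retract Theta ths y).
Let s (zs : X) := pT p zs ths.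
Let q (zs : X) := pT p zs thb.
Let pi y := if y \in Theta then prior y else 0.
Let B (zs : X) := [forall t, enorm (tnth zs t) < Rr].
Let f y := Rr <= enorm (retract Theta ths y).

Let P0 zs y : 0 <= P zs y.
Proof. by apply: (pT_ge0 p_ge0); exact: retract_in. Qed.
Let s0 zs : 0 <= s zs. Proof. exact: (pT_ge0 p_ge0). Qed.
Let q0 zs : 0 <= q zs. Proof. exact: (pT_ge0 p_ge0). Qed.
Let pi0 y : 0 <= pi y. Proof. by rewrite /pi; case: ifPn => // /set_mem; exact: prior0. Qed.
Let P_gt0 zs y : 0 < s zs -> 0 < P zs y.
Proof. by apply: (pT_gt0 p_ge0 regular) => //; exact: retract_in. Qed.
Let q_gt0 zs : 0 < s zs -> 0 < q zs.
Proof. exact: (pT_gt0 p_ge0 regular). Qed.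

Let mP : measurable_fun setT (fun z : X * vec d => P z.1 z.2).
Proof. exact: (measurable_pT mTheta Tths mp). Qed.

Let mpT th : Theta th -> measurable_fun setT (fun zs : X => pT p zs th).
Proof.
move=> Th; have := @measurable_section2 _ _ _ _ _ _ (fun zs y => P zs y) th mP.
by rewrite /P retract_id.
Qed.

Let ms : measurable_fun setT s. Proof. exact: mpT. Qed.
Let mq : measurable_fun setT q. Proof. exact: mpT. Qed.

Let mpi : measurable_fun setT pi.
Proof.
apply: measurable_fun_if => //; first exact: measurable_mem_set.
rewrite (_ : _ `&` _ = Theta)//; apply/seteqP; split => y /=.
  by move=> [_ /set_mem].
by move=> Ty; split => //; rewrite mem_set.
Qed.

Let mf : measurable_fun setT f.
Proof.
apply: measurable_fun_ler; first exact: measurable_cst.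
by apply: measurableT_comp; [exact: measurable_enorm|exact: measurable_retract].
Qed.

Let S_ge0 zs : 0 < s zs -> (0 <= S zs)%E.
Proof.
move=> sz; apply: ereal_sup_ubound; exists thb => //.
by rewrite /elogratio q_gt0//= divff ?ln1// gt_eqF// q_gt0.
Qed.

Let S_ge zs y : 0 < s zs -> ((ln (P zs y / q zs))%:E <= S zs)%E.
Proof.
move=> sz; apply: ereal_sup_ubound; exists (retract Theta ths y); first exact: retract_in.
by rewrite /elogratio -/(P zs y) -/(q zs) P_gt0// q_gt0.
Qed.

Let E1 : set X := fun zs =>
  (ereal_sup [set (pT p zs th)%:E | th in [set th | Theta th /\ (Rr <= enorm th)%R]]
    >= (pT p zs thb)%:E)%E.
Let E2 : set X := fun zs => exists t : 'I_T, (Rr <= enorm (tnth zs t))%R.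

Let E1P zs y : 0 < s zs -> B zs -> f y -> q zs < P zs y -> E1 zs.
Proof.
move=> _ _ fy qP; apply: (@le_trans _ _ (P zs y)%:E); first by rewrite lee_fin ltW.
apply: ereal_sup_ubound; exists (retract Theta ths y) => //.
by split => //; exact: retract_in.
Qed.

Let E2P zs : 0 < s zs -> ~~ B zs -> E2 zs.
Proof.
by move=> _; rewrite negb_forall => /existsP[t]; rewrite -leNgt; exists t.
Qed.

(** Regularity bounds log-ratios from above only, so the absolute value takes it in both directions.
    The hypothesis [small] makes the [T] factors together vary by at most 1/2 within a cell. *)
Let cover : exists (J : finType) (k : J -> vec d),
  (forall y, ~~ f y -> exists j, forall zs, B zs -> 0 < s zs ->
    `|ln (P zs y / P zs (k j))| <= 2^-1) /\
  #|J|%:R <= (2 * Rr / h + 1) ^+ d.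
Proof.
have [J [k [Tk kP cardJ]]] := grid_cover Tths Rr0 h0.
exists J, k; split => // y; rewrite -ltNge => fy.
have Ty := retract_in Tths y.
have [j [kj [d1 d2]]] := kP _ Ty fy.
exists j => zs /forallP Bz sz.
have lip th th' : Theta th -> Theta th' -> enorm th < Rr -> enorm th' < Rr ->
    Defs.edist th th' <= h * (1 + d%:R) -> ln (pT p zs th / pT p zs th') <= 2^-1.
  move=> Th Th' hth hth' dth; apply: le_trans small.
  have pth : 0 < pT p zs th by exact: (pT_gt0 p_ge0 regular Tths).
  apply: le_trans (pT_lipschitz p_ge0 regular Rr0 Th (ltW hth) Th' (ltW hth') _ pth) _.
    by move=> t; apply/ltW/Bz.
  apply: ler_wpM2l; first exact: ler0n.
  apply: (@le_trans _ _ (L * Defs.edist th th')).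
    by apply: ler_wpM2r => //; exact: sqrtr_ge0.
  exact: ler_wpM2l.
have Pk : P zs (k j) = pT p zs (k j) by rewrite /P retract_id.
have := lip _ _ Ty (Tk j) fy kj d1; have := lip _ _ (Tk j) Ty kj fy d2.
rewrite -/(P zs y) -Pk !lnV_lesub ?P_gt0// ler_norml => a1 a2.
by apply/andP; split; lra.
Qed.

Variable mu : {sigma_finite_measure set (T.-tuple (@vec R dz)) -> \bar R}.
Variable nu : {sigma_finite_measure set (@vec R d) -> \bar R}.
Hypotheses (rmu : represents (@lebZ R dz T) mu) (rnu : represents (@leb R d) nu).

Let mI : monotone_functional (@lebZ R dz T).
Proof. by move=> g1 g2; exact: monotone_lebZ. Qed.

Let EZ_ge0 (g : X -> \bar R) : (forall zs, 0 < s zs -> (0 <= g zs)%E) ->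
  EZ p ths g = lebZ (fun zs => (s zs)%:E * g zs)%E.
Proof.
move=> g0; rewrite /EZ (sint_ge0 rmu)// => zs.
have := s0 zs; rewrite le_eqVlt => /orP[/eqP sz|sz].
  by rewrite -/(s zs) -sz mul0e.
by apply: mule_ge0; [rewrite lee_fin; exact: s0|exact: g0].
Qed.

Let intP y : (\int[mu]_zs (P zs y)%:E <= 1)%E.
Proof.
rewrite -rmu.
- by rewrite (lebZ_pT p_ge0)//; exact: retract_in.
- by apply/measurable_EFinP; exact: (@measurable_section2 _ _ _ _ _ _ P y mP).
- by move=> zs; rewrite lee_fin.
Qed.

Let int_pT th : Theta th -> (\int[mu]_zs (pT p zs th)%:E = 1)%E.
Proof.
move=> Th; rewrite -rmu; first exact: (lebZ_pT p_ge0).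
- by apply/measurable_EFinP; exact: mpT.
- by move=> zs; rewrite lee_fin; exact: (pT_ge0 p_ge0).
Qed.

Let ints : (\int[mu]_zs (s zs)%:E = 1)%E. Proof. exact: int_pT. Qed.
Let intq : (\int[mu]_zs (q zs)%:E <= 1)%E. Proof. by rewrite int_pT. Qed.

Let intThetaE (hh k : vec d -> \bar R) : measurable_fun setT k ->
  (forall y, 0 <= k y)%E ->
  (forall y, Theta y -> hh y = k y) -> (forall y, ~ Theta y -> k y = 0%E) ->
  intTheta Theta hh = (\int[nu]_y k y)%E.
Proof.
move=> mk k0 hk k0'; rewrite /intTheta.
rewrite (_ : (fun th => _) = k).
  by rewrite (sint_ge0 rnu)// rnu.
apply/funext => y; case: ifPn => [/set_mem /hk//|ny]; apply/esym/k0'.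
by move=> Ty; move: ny; rewrite mem_set.
Qed.

Let pi_in y : Theta y -> pi y = prior y.
Proof. by move=> Ty; rewrite /pi mem_set. Qed.

Let pi_out y : ~ Theta y -> pi y = 0.
Proof. by rewrite /pi; case: ifPn => // /set_mem. Qed.

Let intpi : (\int[nu]_y (pi y)%:E = 1)%E.
Proof.
rewrite -prior1; apply/esym; apply: intThetaE.
- exact/measurable_EFinP.
- by move=> y; rewrite lee_fin.
- by move=> y Ty; rewrite pi_in.
- by move=> y Ty; rewrite pi_out.
Qed.

Let mPz zs : measurable_fun setT (P zs).
Proof. exact: (@measurable_section1 _ _ _ _ _ _ P zs mP). Qed.

Let evidence_intTheta zs :
  intTheta Theta (fun th => (prior th * pT p zs th)%:E) = evidence nu P pi zs.
Proof.
apply: intThetaE.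
- by apply/measurable_EFinP; exact: measurable_funM.
- by move=> y; rewrite lee_fin mulr_ge0.
- by move=> y Ty; rewrite pi_in// /P retract_id.
- by move=> y Ty; rewrite pi_out// mul0r.
Qed.

Let D := divergence mu P s r.
Let kap := (T%:R * (1 - r))^-1.

Let kap0 : 0 < kap.
Proof. by rewrite invr_gt0 mulr_gt0 ?ltr0n//; case/andP: r01 => ? ?; lra. Qed.

Let D0 y : 0 <= D y.
Proof. exact: (divergence_ge0 mP ms P0 s0 P_gt0 intP ints r01). Qed.

Let mD : measurable_fun setT D.
Proof. exact: (measurable_divergence mu mP ms s0). Qed.

Let renyiE th : Theta th -> renyi p r T th ths = (kap * D th)%:E.
Proof.
move=> Th; rewrite /renyi -/kap EZ_ge0; last first.
  by move=> zs _; rewrite lee_fin; apply: prodr_ge0 => t _; exact: powR_ge0.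
have -> : (fun zs : X => (s zs)%:E *
    (\prod_(t < T) ((p (take t zs) (tnth zs t) th / p (take t zs) (tnth zs t) ths) `^ r))%:E)%E
    = (fun zs : X => (s zs * (if xpredT zs then expR (r * ln (P zs th / s zs)) else 0))%:E).
  apply/funext => zs; rewrite -EFinM; congr EFin.
  (* Where [s] vanishes both integrands are 0, whatever the quotients by zero are worth. *)
  have := s0 zs; rewrite le_eqVlt => /orP[/eqP <-|sz]; first by rewrite !mul0r.
  rewrite prod_powR; last by move=> t; rewrite divr_ge0// p_ge0.
  rewrite prodf_div -/(pT p zs th) -/(pT p zs ths) -/(s zs).
  have Pz := P_gt0 th sz; rewrite /P retract_id// in Pz *.
  by rewrite /powR gt_eqF// divr_gt0.
rewrite rmu; last 2 first.
- apply/measurable_EFinP.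
  apply: (@measurable_affinity_integrand R _ _ s r ms xpredT (P ^~ th)).
    exact: measurable_cst.
  exact: (@measurable_section2 _ _ _ _ _ _ P th mP).
- by move=> zs; rewrite lee_fin mulr_ge0// expR_ge0.
rewrite -[(\int[mu]_zs _)%E]/(affinity mu s r xpredT (P ^~ th)).
rewrite (affinity_divergence mP ms P0 s0 P_gt0 intP ints r01) lne_EFin ?expR_gt0//.
by rewrite expRK -EFinN -EFinM mulrNN.
Qed.

Let postE_risk zs : 0 < s zs -> (evidence nu P pi zs < +oo)%E ->
  postE p Theta prior zs (fun th => renyi p r T th ths) =
  (kap%:E * (\int[nu]_y (pi y * P zs y * D y)%:E *
    ((fine (evidence nu P pi zs))^-1)%:E))%E.
Proof.
move=> sz Nz; rewrite /postE evidence_intTheta Nz.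
rewrite (evidence_gt0 mP mpi P0 pi0 P_gt0 intpi sz)/= muleA; congr (_ * _)%E.
rewrite (intThetaE (k := fun y => kap%:E * (pi y * P zs y * D y)%:E)%E).
- rewrite ge0_integralZl ?lee_fin ?(ltW kap0)//.
  + by apply/measurable_EFinP; do 2 apply: measurable_funM => //.
  + by move=> y _; rewrite lee_fin !mulr_ge0.
- apply/measurable_EFinP; apply: measurable_funM => //.
  by do 2 apply: measurable_funM => //.
- by move=> y; rewrite -EFinM lee_fin !mulr_ge0// ltW.
- by move=> y Ty; rewrite renyiE// pi_in// /P retract_id// -!EFinM; congr EFin; ring.
- by move=> y Ty; rewrite pi_out// !mul0r mule0.
Qed.

Let pos_part (u : X -> R) : \bar R := (\int[mu]_zs (s zs * Num.max (u zs) 0)%:E)%E.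

Let EZ_real (g : X -> \bar R) (u : X -> R) : measurable_fun setT u ->
  (forall zs, 0 < s zs -> g zs = (u zs)%:E) ->
  EZ p ths g = (pos_part u - pos_part (fun zs => - u zs)%R)%E.
Proof.
move=> mu' gu; rewrite /EZ /sint.
have mpos (v : X -> R) : measurable_fun setT v ->
    measurable_fun setT (fun zs => (s zs * Num.max (v zs) 0)%:E).
  move=> mv; apply/measurable_EFinP; apply: measurable_funM => //.
  exact: measurable_maxr.
have E zs : ((pT p zs ths)%:E * g zs = (s zs * u zs)%:E)%E.
  rewrite -/(s zs); have := s0 zs; rewrite le_eqVlt => /orP[/eqP <-|sz].
    by rewrite mul0e mul0r.
  by rewrite gu.
congr (_ - _)%E.
- rewrite (_ : (fun zs => _) = fun zs => (s zs * Num.max (u zs) 0)%:E).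
    rewrite rmu//; first exact: mpos.
    by move=> zs; rewrite lee_fin mulr_ge0// le_max lexx orbT.
  by apply/funext => zs; rewrite E maxr_mul_pos.
- rewrite (_ : (fun zs => _) = fun zs => (s zs * Num.max (- u zs) 0)%:E).
    rewrite rmu//; first by apply: mpos; exact: measurable_funN.
    by move=> zs; rewrite lee_fin mulr_ge0// le_max lexx orbT.
  by apply/funext => zs; rewrite E -EFinN -mulrN maxr_mul_pos.
Qed.

Let klp := pos_part (fun zs => ln (s zs / q zs)).
Let klm := pos_part (fun zs => - ln (s zs / q zs)).
Let lp y := pos_part (fun zs => ln (P zs y / q zs)).
Let lm y := pos_part (fun zs => - ln (P zs y / q zs)).

Let KLTE : KLT p T ths thb = (klp - klm)%E.
Proof.
apply: EZ_real; first by apply: measurable_fun_ln; exact: measurable_fun_div.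
by move=> zs sz; rewrite /elogratio -/(s zs) -/(q zs) sz q_gt0.
Qed.

Let tilt_E th : Theta th ->
  EZ p ths (fun zs : X => elogratio (pT p zs thb) (pT p zs th)) = (lm th - lp th)%E.
Proof.
move=> Th; rewrite (EZ_real (u := fun zs => - ln (P zs th / q zs))).
- congr (_ - _)%E; congr integral; apply/funext => zs; rewrite opprK//.
- apply: measurable_funN; apply: measurable_fun_ln; apply: measurable_fun_div => //.
  exact: (@measurable_section2 _ _ _ _ _ _ P th mP).
- move=> zs sz; have Pz := P_gt0 th sz; have qz := q_gt0 sz.
  rewrite /P retract_id// in Pz *; rewrite /elogratio -/(q zs) qz Pz/=.
  by rewrite !lnV_lesub// opprB.
Qed.

Let Mass := (\int[nu]_y ((pi y)%:E * expeR (- (lm y - lp y))))%E.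

Let mtilt : measurable_fun setT (fun y => (pi y)%:E * expeR (- (lm y - lp y)))%E.
Proof.
have mPq : measurable_fun setT (fun z : X * vec d => ln (P z.1 z.2 / q z.1)).
  apply: measurable_fun_ln; apply: measurable_fun_div => //.
  exact: (measurableT_comp mq measurable_fst).
apply: emeasurable_funM; first exact/measurable_EFinP.
apply: measurable_fun_expeR; apply: measurableT_comp => //; apply: emeasurable_funB.
- apply: (@measurable_integral1 R _ _ _ _ mu
    (fun zs y => (s zs * Num.max (- ln (P zs y / q zs)) 0)%:E)).
    apply/measurable_EFinP; apply: measurable_funM.
      exact: (measurableT_comp ms measurable_fst).
    by apply: measurable_maxr => //; exact: measurable_funN.
  by move=> zs y; rewrite lee_fin mulr_ge0 ?s0// le_max lexx orbT.
- apply: (@measurable_integral1 R _ _ _ _ mu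
    (fun zs y => (s zs * Num.max (ln (P zs y / q zs)) 0)%:E)).
    apply/measurable_EFinP; apply: measurable_funM.
      exact: (measurableT_comp ms measurable_fst).
    exact: measurable_maxr.
  by move=> zs y; rewrite lee_fin mulr_ge0 ?s0// le_max lexx orbT.
Qed.

Let tilt0 y : (0 <= (pi y)%:E * expeR (- (lm y - lp y)))%E.
Proof. by rewrite mule_ge0 ?lee_fin// expeR_ge0. Qed.

Let MassE : intTheta Theta (fun th => ((prior th)%:E *
    expeR (- EZ p ths (fun zs : X => elogratio (pT p zs thb) (pT p zs th))))%E) = Mass.
Proof.
apply: intThetaE => //.
- by move=> y Ty; rewrite tilt_E// pi_in.
- by move=> y Ty; rewrite pi_out// mul0e.
Qed.

Let moment' : (lebZ (fun zs : X => (s zs)%:E * (S zs * S zs)) <= c%:E)%E.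
Proof. by rewrite -EZ_ge0// => zs sz; rewrite mule_ge0// S_ge0. Qed.

Let tail1' : (lebZ (fun zs : X => (s zs)%:E * (\1_E1 zs)%:E) <= e%:E)%E.
Proof. by rewrite -EZ_ge0// => zs sz; rewrite lee_fin. Qed.

Let tail2' : (lebZ (fun zs : X => (s zs)%:E * (\1_E2 zs)%:E) <= e%:E)%E.
Proof. by rewrite -EZ_ge0// => zs sz; rewrite lee_fin. Qed.

Let g := lam * c + 2 * e / lam.
Let K := 4 + ln (1 + (2 * Rr / h + 1) ^+ d) + g + r + (1 + r) * (g + 2).

Lemma fixed_horizon_represented :
  (EZ p ths (fun zs : X => postE p Theta prior zs (fun th => renyi p r T th ths))
   <= - ((1 + r) / ((1 - r) * T%:R))%:E *
       lne (intTheta Theta (fun th => ((prior th)%:E *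
               expeR (- EZ p ths (fun zs : X => elogratio (pT p zs thb) (pT p zs th))))%E))
   + ((1 + r) / (1 - r))%:E * (KLT p T ths thb * (T%:R^-1)%:E)
   + (K / (T%:R * (1 - r)))%:E)%E.
Proof.
have /andP[r0 r1] := r01; have T0 : 0 < T%:R :> R by rewrite ltr0n.
have rr : 0 < 1 - r by lra.
rewrite MassE KLTE.
have [J [k [kP cardJ]]] := cover.
have [F [mF F0 F_ge F_oo intF]] := oracle_majorant mP ms mq mpi P0 s0 q0 pi0 P_gt0 q_gt0
  intP ints intq intpi mI rmu mf (bounded_tuple_measurable (R := R) (n := dz) (T := T) Rr)
  S_ge0 S_ge E1P E2P moment' tail1' tail2' lam0 e1 r01 kP.
have bound : (EZ p ths (fun zs : X => postE p Theta prior zs (fun th => renyi p r T th ths))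
    <= kap%:E * \int[mu]_zs F zs)%E.
  apply: le_trans (sint_le_pos _ mI rmu) _.
  rewrite -ge0_integralZl ?lee_fin ?(ltW kap0)// -rmu; first last.
  - by move=> zs; rewrite mule_ge0// lee_fin ltW.
  - by apply: emeasurable_funM => //; exact: measurable_cst.
  apply: mI => zs; first by rewrite le_max lexx orbT.
  have Fz : (0 <= kap%:E * F zs)%E by rewrite mule_ge0// lee_fin ltW.
  rewrite ge_max Fz andbT -/(s zs).
  have := s0 zs; rewrite le_eqVlt => /orP[/eqP <-|sz]; first by rewrite mul0e.
  have [Nz|] := ltP (evidence nu P pi zs) +oo%E.
    rewrite postE_risk// muleCA; apply: lee_wpmul2l; first by rewrite lee_fin ltW.
    exact: F_ge.
  by rewrite leye_eq => /eqP Nz; rewrite (F_oo _ sz Nz) gt0_muley ?lte_fin// leey.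
apply: le_trans bound _.
have klm1 : (klm <= 1)%E := log_loss_neg_le1 s0 q0 q_gt0 intq.
have pp0 u : (0 <= pos_part u)%E.
  by apply: integral_ge0 => zs _; rewrite lee_fin mulr_ge0// le_max lexx orbT.
have /fineK klmE : klm \is a fin_num.
  by rewrite ge0_fin_numE ?pp0// (le_lt_trans klm1)// ltry.
have Mass0 : (0 <= Mass)%E by apply: integral_ge0 => y _; exact: tilt0.
(* Each exponent is at most [lp y <= 1 + c]; a finite mass keeps the logarithmic term away from
   [-oo]. *)
have Mass_oo : (Mass < +oo)%E.
  apply: (@le_lt_trans _ _ (\int[nu]_y ((expR (1 + c))%:E * (pi y)%:E))%E).
    apply: ge0_le_integralT => y; first exact: tilt0.
    rewrite muleC; apply: lee_wpmul2r; first by rewrite lee_fin.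
    have := log_gain_le mP ms mq s0 ints mI rmu S_ge0 S_ge moment' y.
    rewrite -/(pos_part _) -/(lp y).
    have := pp0 (fun zs => ln (P zs y / q zs)); rewrite -/(lp y).
    case: (lp y) => [a| |]// a0 ac.
    have := pp0 (fun zs => - ln (P zs y / q zs)); rewrite -/(lm y).
    case: (lm y) => [b| |]// b0; last first.
      by rewrite /= lee_fin; exact: expR_ge0.
    rewrite /= lee_fin ler_expR; move: ac b0; rewrite !lee_fin; lra.
  have mpie : measurable_fun setT (EFin \o pi) by exact/measurable_EFinP.
  have pie y : (0 <= (pi y)%:E)%E by rewrite lee_fin.
  by rewrite ge0_integralZl// ?lee_fin ?expR_ge0// intpi mule1 ltry.
have coef1 : (0 < (1 + r) / ((1 - r) * T%:R)) by rewrite divr_gt0 ?mulr_gt0//; lra.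
have coef2 : (0 < (1 + r) / (1 - r)) by rewrite divr_gt0//; lra.
have Ti : 0 < (T%:R^-1 : R) by rewrite invr_gt0.
have := Mass0; move EM : Mass => M0; case: M0 EM => [M| |] EM //; last first.
  by move: Mass_oo; rewrite EM.
(* Zero mass and infinite [klp] are degenerate: either makes the right-hand side [+oo], and
   finiteness of [klm] excludes a competing [-oo]. *)
rewrite lee_fin le_eqVlt => /orP[/eqP M0|M0].
  rewrite -M0 le0_lneNy// mulNe gt0_muleNy ?lte_fin//.
  have := pp0 (fun zs => ln (s zs / q zs)); rewrite -/klp -klmE.
  case: klp => [a| |] // _; first by rewrite -!EFinB -!EFinM !addye// leey.
  by rewrite /= gt0_mulye ?lte_fin// gt0_muley ?lte_fin//= leey.
have [klp_oo|] := ltP klp +oo%E; last first.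
  rewrite leye_eq => /eqP ->; rewrite -klmE lne_EFin//=.
  by rewrite gt0_mulye ?lte_fin// gt0_muley ?lte_fin//= leey.
have /fineK klpE : klp \is a fin_num by rewrite ge0_fin_numE ?pp0.
have kapF := lee_wpmul2l (_ : (0 <= kap%:E)%E) (intF M M0 klp_oo EM).
apply: le_trans (kapF _) _; first by rewrite lee_fin ltW.
rewrite -/klp -/klm.
pose kl := fine klp - fine klm.
have -> : (klp - klm = kl%:E)%E by rewrite -klpE -klmE -EFinB.
rewrite lne_EFin//.
have lnJ : ln (1 + #|J|%:R) <= ln (1 + (2 * Rr / h + 1) ^+ d) :> R.
  rewrite ler_ln ?posrE ?ltr_pwDl// ?lerD2l// exprn_ge0// addr_ge0//.
  by rewrite divr_ge0 ?mulr_ge0// ltW.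
have H : kap * (4 + ln (1 + #|J|%:R) + g + r + (1 + r) * (g + 2 - ln M + kl)) <=
    - ((1 + r) / ((1 - r) * T%:R)) * ln M + (1 + r) / (1 - r) * (kl * T%:R^-1) +
    K / (T%:R * (1 - r)).
  have -> : - ((1 + r) / ((1 - r) * T%:R)) * ln M + (1 + r) / (1 - r) * (kl * T%:R^-1) +
      K / (T%:R * (1 - r)) = kap * (K + (1 + r) * (kl - ln M)).
    rewrite /kap; field; apply/andP; split; rewrite gt_eqF//.
  apply: ler_wpM2l; first exact: ltW.
  rewrite /K; lra.
by move: H; rewrite -lee_fin.
Qed.

End FixedHorizon.

(** * Dependence of the constants on the horizon *)

Section Constants.
Set Implicit Arguments.
Unset Strict Implicit.
Context {R : realType}.

Lemma ln_le_scale (x y l : R) : 1 <= l -> 0 <= y -> x <= y -> x <= y * l.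
Proof. by move=> l1 y0 xy; apply: (le_trans xy); rewrite ler_peMr. Qed.

(** Radius and grid size are polynomial in [T], so their logarithms are at most constants times
    [l = 1 + ln T]; [u1], [w1] and [z1] are these constants for [U], [W = 1 + Rr] and the bound [Z]
    on the base of the grid size. *)
Lemma log_cover_le (a b k L0 : R) (n m d : nat) : 1 <= a -> 1 <= b -> 1 <= k -> 1 <= L0 ->
  exists A : R, forall (T : nat), (1 <= T)%N ->
   let t := 1 + T%:R in
   let Rr := (2 * a * b * t ^+ n) `^ k in
   let L := L0 * (1 + Rr) ^+ m in
   ln (1 + (2 * Rr / (2 * T%:R * L * (1 + d%:R))^-1 + 1) ^+ d) <= A * (1 + ln T%:R).
Proof.
move=> a1 b1 k1 L1.
pose u1 := ln (2 * a * b) + n%:R.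
pose w1 := 1 + k * u1.
pose z1 := ln (5 * L0 * (1 + d%:R)) + 1 + m.+1%:R * w1.
exists (1 + d%:R * z1) => T T1; cbv zeta.
set t := 1 + T%:R; set U := 2 * a * b * t ^+ n; set Rr := U `^ k.
set W := 1 + Rr; set l := 1 + ln T%:R.
have d0 : 0 <= d%:R :> R by exact: ler0n.
have n0 : 0 <= n%:R :> R by exact: ler0n.
have m0 : 0 <= m.+1%:R :> R by exact: ler0n.
have T1' : 1 <= T%:R :> R by rewrite ler1n.
have l1 : 1 <= l by rewrite /l lerDl ln_ge0.
have ln2 : ln (2 : R) <= 1 by have := @ln_le_subr1 R 2; lra.
have t1 : 1 <= t by rewrite /t; lra.
have lnt0 : 0 <= ln t by exact: ln_ge0.
have lnt : ln t <= l.
  have : ln t <= ln (2 * T%:R) by rewrite ler_ln ?posrE /t; lra.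
  by rewrite lnM ?posrE /l; lra.
have ab : 1 <= a * b by rewrite -[leLHS]mulr1; apply: ler_pM.
have ab2 : 1 <= 2 * a * b by rewrite -mulrA; lra.
have tn : 1 <= t ^+ n by exact: exprn_ege1.
have U1 : 1 <= U by rewrite /U -[leLHS]mulr1; apply: ler_pM.
have ln2ab : 0 <= ln (2 * a * b) by exact: ln_ge0.
have u10 : 0 <= u1 by rewrite /u1 addr_ge0.
have lnU : ln U <= u1 * l.
  have p1 : 0 < 2 * a * b by lra.
  have p2 : 0 < t ^+ n by lra.
  have t0 : 0 < t by lra.
  have -> : ln U = ln (2 * a * b) + n%:R * ln t.
    by rewrite /U lnM ?posrE// lnXn// [n%:R * _]mulr_natl.
  have -> : u1 * l = ln (2 * a * b) * l + n%:R * l by rewrite /u1 mulrDl.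
  by apply: lerD; [exact: ln_le_scale|exact: ler_wpM2l].
have k0 : 0 <= k by lra.
have w10 : 0 <= w1 by rewrite /w1 addr_ge0// mulr_ge0.
have Rr1 : 1 <= Rr by rewrite -(powRr0 U); apply: ler_powR.
have lnW : ln W <= w1 * l.
  have : ln W <= ln (2 * Rr) by rewrite ler_ln ?posrE /W; lra.
  rewrite lnM ?posrE//; last by lra.
  rewrite /Rr ln_powR /w1 mulrDl mul1r -mulrA => H.
  have := ler_wpM2l k0 lnU; lra.
have W1 : 1 <= W by rewrite /W; lra.
have Ld : 1 <= 5 * L0 * (1 + d%:R).
  have : 1 * 1 <= L0 * (1 + d%:R) by apply: ler_pM => //; lra.
  lra.
(* Of the 5, four come from the two factors 2 in the base, and one absorbs the summand 1, since the
   product it is added to is at least 1. *)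
pose Z := 5 * L0 * (1 + d%:R) * (t * W ^+ m.+1).
have Wm : 1 <= W ^+ m.+1 by exact: exprn_ege1.
have tW : 1 <= t * W ^+ m.+1 by rewrite -[leLHS]mulr1; apply: ler_pM.
have Z1 : 1 <= Z by rewrite /Z -[leLHS]mulr1; apply: ler_pM.
have z10 : 0 <= z1 by rewrite /z1 addr_ge0 ?mulr_ge0// addr_ge0// ln_ge0.
have lnZ : ln Z <= z1 * l.
  have p1 : 0 < 5 * L0 * (1 + d%:R) by lra.
  have p2 : 0 < W ^+ m.+1 by lra.
  have p3 : 0 < t * W ^+ m.+1 by lra.
  have W0 : 0 < W by lra.
  have t0 : 0 < t by lra.
  have -> : ln Z = ln (5 * L0 * (1 + d%:R)) + ln t + m.+1%:R * ln W.
    by rewrite /Z lnM ?posrE// [ln (t * _)]lnM ?posrE// [ln (W ^+ _)]lnXn// [m.+1%:R * _]mulr_natl addrA.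
  have -> : z1 * l = ln (5 * L0 * (1 + d%:R)) * l + l + m.+1%:R * (w1 * l).
    by rewrite /z1; ring.
  apply: lerD; last exact: ler_wpM2l.
  by apply: lerD => //; apply: ln_le_scale => //; exact: ln_ge0.
have base : 2 * Rr / (2 * T%:R * (L0 * W ^+ m) * (1 + d%:R))^-1 + 1 <= Z.
  rewrite invrK.
  have q0 : 1 <= T%:R * (L0 * W ^+ m) * (1 + d%:R).
    rewrite -[leLHS]mulr1; apply: ler_pM => //; last lra.
    rewrite -[leLHS]mulr1; apply: ler_pM => //.
    by rewrite -[leLHS]mulr1; apply: ler_pM => //; exact: exprn_ege1.
  have RW : Rr <= W by rewrite /W; lra.
  have qt : T%:R * (L0 * W ^+ m) * (1 + d%:R) <= t * (L0 * W ^+ m) * (1 + d%:R).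
    apply: ler_wpM2r; first lra.
    apply: ler_wpM2r; last by rewrite /t; lra.
    by rewrite mulr_ge0 ?exprn_ge0//; lra.
  have p1 : Rr * (T%:R * (L0 * W ^+ m) * (1 + d%:R)) <= W * (t * (L0 * W ^+ m) * (1 + d%:R)).
    by apply: ler_pM => //; lra.
  have p2 : 1 <= Rr * (T%:R * (L0 * W ^+ m) * (1 + d%:R)).
    by rewrite -[leLHS]mulr1; apply: ler_pM.
  have -> : Z = 5 * (W * (t * (L0 * W ^+ m) * (1 + d%:R))) by rewrite /Z exprS; ring.
  have -> : 2 * Rr * (2 * T%:R * (L0 * W ^+ m) * (1 + d%:R)) =
     4 * (Rr * (T%:R * (L0 * W ^+ m) * (1 + d%:R))) by ring.
  lra.
have base0 : 0 <= 2 * Rr / (2 * T%:R * (L0 * W ^+ m) * (1 + d%:R))^-1 + 1.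
  rewrite invrK; apply: addr_ge0 => //; rewrite !mulr_ge0 ?exprn_ge0//; lra.
set y := _ + 1 in base base0 *.
have yd : y ^+ d <= Z ^+ d by apply: lerXn2r => //; rewrite nnegrE; lra.
have yd0 : 0 <= y ^+ d by exact: exprn_ge0.
have Zd : 1 <= Z ^+ d by exact: exprn_ege1.
have : ln (1 + y ^+ d) <= ln (2 * Z ^+ d) by rewrite ler_ln ?posrE; lra.
move=> H; apply: (le_trans H).
have Z0 : 0 < Z by lra.
have Zd0 : 0 < Z ^+ d by lra.
have -> : ln (2 * Z ^+ d) = ln 2 + d%:R * ln Z by rewrite lnM ?posrE// lnXn// [d%:R * _]mulr_natl.
have -> : (1 + d%:R * z1) * l = l + d%:R * (z1 * l) by ring.
by apply: lerD; [exact: le_trans l1|exact: ler_wpM2l].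
Qed.

End Constants.

Theorem theoremD1 (R : realType) (d dz : nat)
  (Theta : set (@vec R d))
  (p : seq (@vec R dz) -> @vec R dz -> @vec R d -> R)
  (ths thb : @vec R d) :
  measurable Theta ->
  (* each p_t(. | z_{1:t-1}, th) is a probability density on R^dz *)
  (forall hist z th, Theta th -> 0 <= p hist z th) ->
  (forall hist th, Theta th -> leb (fun z => (p hist z th)%:E) = 1%E) ->
  (* joint measurability of (z_{1:t}, th) |-> p_t(z_t | z_{1:t-1}, th) *)
  (forall t : nat,
     measurable_fun (setT `*` Theta)
       (fun x : (t.+1).-tuple (@vec R dz) * @vec R d =>
          p (take t x.1) (tnth x.1 ord_max) x.2)) ->
  Theta ths -> Theta thb ->
  DG p Theta ths thb ->
  forall r : R, 0 < r < 1 ->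
  exists C : R,
  forall prior : @vec R d -> R,
    measurable_fun Theta prior ->
    (forall th, Theta th -> 0 <= prior th) ->
    intTheta Theta (fun th => (prior th)%:E) = 1%E ->
    0 < prior thb ->
  forall T : nat, (1 <= T)%N ->
  (EZ p ths (fun zs : T.-tuple (@vec R dz) =>
      postE p Theta prior zs (fun th => renyi p r T th ths))
   <=
   - ((1 + r) / ((1 - r) * T%:R))%:E *
       lne (intTheta Theta (fun th =>
              ((prior th)%:E *
               expeR (- EZ p ths (fun zs : T.-tuple (@vec R dz) =>
                          elogratio (pT p zs thb) (pT p zs th))))%E))
   + ((1 + r) / (1 - r))%:E * (KLT p T ths thb * (T%:R^-1)%:E)
   + (C * (1 + ln T%:R) / T%:R)%:E)%E.
Proof.
move=> mTheta p_ge0 p_int mp Tths Tthb.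
move=> [[k [ca [ma [k1 tails]]]] [[cb [mb moment]] [cc [mc regular]]]] r r01.
have /andP[r0 r1] := r01.
(* The polynomial coefficients may be small or negative; enlarging them to at least 1 makes all
   later products monotone. *)
pose a := `|ca| + 1; pose b := `|cb| + 1; pose L0 := `|cc| + 1.
have a1 : 1 <= a by rewrite lerDr.
have b1 : 1 <= b by rewrite lerDr.
have L1 : 1 <= L0 by rewrite lerDr.
have [A logA] := log_cover_le (ma + mb).+1 mc d a1 b1 k1 L1.
(* With tail cost [g = 2], the constant of the fixed-horizon bound is
   [4 + 2 + r + (1 + r) * 4 = 10 + 5 * r] plus the logarithm bounded by [A]. It is fixed before the
   prior and [T] are introduced. *)
exists ((10 + 5 * r + A) / (1 - r)) => prior mprior prior0 prior1 _ T T1.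
have T1' : 1 <= T%:R :> R by rewrite ler1n.
have := logA T T1; cbv zeta; set t := 1 + T%:R.
set U := 2 * a * b * t ^+ (ma + mb).+1; set Rr := U `^ k.
(* [L] dominates the Lipschitz constant on the ball, and [h] is the mesh for which
   [T * L * h * (1 + d)] equals 1/2. *)
set L := L0 * (1 + Rr) ^+ mc; set h := (2 * T%:R * L * (1 + d%:R))^-1.
move=> lnA.
(* [c] bounds the second moment. With tail probability [e = 1 / (2 * c)] and parameter
   [lam = 1 / c], the tail cost [lam * c + 2 * e / lam] equals 2 for every [T]. *)
pose c := b * t ^+ mb; pose e := (2 * c)^-1.
have t1 : 1 <= t by rewrite /t; lra.
have tma : 1 <= t ^+ ma by exact: exprn_ege1.
have tmb : 1 <= t ^+ mb by exact: exprn_ege1.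
have c1 : 1 <= c by rewrite /c -[leLHS]mulr1; apply: ler_pM.
have c0 : 0 < c by lra.
have ac : 1 <= a * t ^+ ma by rewrite -[leLHS]mulr1; apply: ler_pM.
have UE : U = 2 * c * (a * t ^+ ma) * t by rewrite /U /c exprS exprD; ring.
have ca1 : 1 <= c * (a * t ^+ ma) by rewrite -[leLHS]mulr1; apply: ler_pM.
have tU : t <= U.
  rewrite UE -[leLHS]mul1r; apply: ler_wpM2r; first lra.
  by rewrite -mulrA; lra.
have U0 : 0 < U by lra.
have URr : U <= Rr by rewrite -[leLHS]powRr1 ?ler_powR//; lra.
have Rr0 : 0 < Rr by lra.
have TRr : T%:R <= Rr by apply: (le_trans _ URr); apply: (le_trans _ tU); rewrite /t; lra.
have lam0 : 0 < c^-1 by rewrite invr_gt0.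
have e1 : e <= 2^-1 by rewrite lef_pV2 ?posrE; lra.
have Wm : 1 <= (1 + Rr) ^+ mc by apply: exprn_ege1; lra.
have L2 : 1 <= L by rewrite /L -[leLHS]mulr1; apply: ler_pM.
have d1 : 1 <= 1 + d%:R :> R by rewrite lerDl.
have den : 0 < 2 * T%:R * L * (1 + d%:R) by rewrite !mulr_gt0//; lra.
have h0 : 0 < h by rewrite invr_gt0.
have polyL : polyb cc mc Rr <= L.
  rewrite /polyb /L; apply: ler_wpM2r; first by lra.
  by rewrite (le_trans (ler_norm _))// lerDl.
have small : T%:R * (L * (h * (1 + d%:R))) <= 2^-1.
  rewrite le_eqVlt; apply/orP; left; apply/eqP; rewrite /h; field.
  by rewrite !gt_eqF//; lra.
have moment' : (EZ p ths (fun zs : T.-tuple (@vec R dz) =>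
    let S := ereal_sup [set elogratio (pT p zs th) (pT p zs thb) | th in Theta] in
    S * S)%E <= c%:E)%E.
  apply: le_trans (moment T T1) _; rewrite lee_fin /polyb /c; apply: ler_wpM2r; first lra.
  by rewrite (le_trans (ler_norm _))// lerDl.
have tail_le : polyb ca ma T%:R / (1 + Rr `^ k^-1) <= e.
  have -> : Rr `^ k^-1 = U by rewrite /Rr -powRrM divff ?powRr1 ?gt_eqF//; lra.
  apply: (@le_trans _ _ (a * t ^+ ma / U)).
    apply: (@le_trans _ _ (a * t ^+ ma / (1 + U))).
      apply: ler_wpM2r; first by rewrite invr_ge0; lra.
      rewrite /polyb; apply: ler_wpM2r; first lra.
      by rewrite (le_trans (ler_norm _))// lerDl.
    by apply: ler_wpM2l; [lra|rewrite lef_pV2 ?posrE; lra].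
  rewrite ler_pdivrMr// /e UE.
  have -> : (2 * c)^-1 * (2 * c * (a * t ^+ ma) * t) = a * t ^+ ma * t.
    by field; rewrite gt_eqF.
  by rewrite ler_peMr//; lra.
have [tail1 tail2] := tails T Rr T1 TRr.
have tail1' := le_trans tail1 (_ : ((polyb ca ma T%:R / (1 + Rr `^ k^-1))%:E <= e%:E)%E).
have tail2' := le_trans tail2 (_ : ((polyb ca ma T%:R / (1 + Rr `^ k^-1))%:E <= e%:E)%E).
rewrite lee_fin in tail1' tail2'.
have [mu rmu] := lebZ_represented (R := R) dz T.
have [nu rnu] := leb_represented (R := R) d.
have H := fixed_horizon_represented mTheta p_ge0 p_int mp Tths Tthb regular r01 mprior prior0
  prior1 T1 Rr0 h0 lam0 e1 (le_trans ler01 L2) polyL small moment' (tail1' tail_le)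
  (tail2' tail_le) rmu rnu.
apply: le_trans H _; apply: leeD2l; rewrite lee_fin.
have -> : c^-1 * c + 2 * e / c^-1 = 2 by rewrite /e; field; rewrite gt_eqF.
have rr : 0 < 1 - r by lra.
have l0 : 0 <= ln T%:R :> R by exact: ln_ge0.
set l := 1 + ln T%:R in lnA *.
have -> : (10 + 5 * r + A) / (1 - r) * l / T%:R = (10 + 5 * r + A) * l / (T%:R * (1 - r)).
  by field; rewrite !gt_eqF//; lra.
apply: ler_wpM2r; first by rewrite invr_ge0 mulr_ge0//; lra.
have : (10 + 5 * r) * 1 <= (10 + 5 * r) * l by apply: ler_wpM2l; rewrite /l; lra.
move: lnA; rewrite -/h; lra.
Qed.
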